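(* Let $H$ be a flower. Then the following problem is solvable in polynomial time: given a graph $G$, decide whether $H$ is an induced minor of $G$.
   Context: All graphs are finite, simple and undirected. A graph $H$ is an induced minor of $G$ if $H$ can be obtained from $G$ by deleting vertices and contracting edges. A graph $H$ is a flower if there is a vertex $u\in V(H)$ (the center) such that $H\setminus\{u\}$ is a disjoint union of paths and for each such path $P$, either $P$ has exactly $3$ vertices and $u$ is adjacent to all vertices of $P$, or the neighbors of $u$ in $P$ form a subset (of size $0$, $1$ or $2$) of the set of endpoints of $P$. The graph $H$ is fixed (not part of the input), and polynomial time is measured in the size of $G$. *)

(* Defs.v *)
From HB Require Import structures.
From mathcomp Require Import all_boot.
Set Implicit Arguments.
Unset Strict Implicit.
Unset Printing Implicit Defensive.

Record sgraph := SGraph {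
  svertex :> finType;
  sedge : rel svertex;
  sedge_sym : symmetric sedge;
  sedge_irrefl : irreflexive sedge }.

Definition edges (G : sgraph) : {set {set G}} :=
  [set e | [exists x : G, exists y : G, sedge x y && (e == [set x; y])]].

Definition gsize (G : sgraph) : nat := #|G| + #|edges G|.

Definition iso (G H : sgraph) : Prop :=
  exists2 f : G -> H, bijective f & forall x y, sedge (f x) (f y) = sedge x y.

Section Operations.
Variable G : sgraph.

Section Deletion.
Variable v : G.

Definition del_rel : rel {z : G | z != v} := fun a b => sedge (val a) (val b).

Lemma del_sym : symmetric del_rel.
Proof. by move=> a b; rewrite /del_rel sedge_sym. Qed.

Lemma del_irrefl : irreflexive del_rel.
Proof. by move=> a; rewrite /del_rel sedge_irrefl. Qed.

Definition del_vertex : sgraph := SGraph del_sym del_irrefl.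
End Deletion.

(* The edge xy is contracted onto x: y disappears and x becomes adjacent to
   every former neighbour of x or y. *)
Section Contraction.
Variables x y : G.

Definition contract_rel : rel {z : G | z != y} := fun a b =>
  (a != b) &&
  [|| sedge (val a) (val b),
      (val a == x) && sedge y (val b)
    | (val b == x) && sedge y (val a)].

Lemma contract_sym : symmetric contract_rel.
Proof.
by move=> a b; rewrite /contract_rel eq_sym sedge_sym; congr (_ && (_ || _));
   rewrite orbC.
Qed.

Lemma contract_irrefl : irreflexive contract_rel.
Proof. by move=> a; rewrite /contract_rel eqxx. Qed.

Definition contract_edge : sgraph := SGraph contract_sym contract_irrefl.
End Contraction.

End Operations.

Inductive induced_minor (H : sgraph) : sgraph -> Prop :=
| im_iso (G : sgraph) : iso G H -> induced_minor H G
| im_del (G : sgraph) (v : G) :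
    induced_minor H (del_vertex v) -> induced_minor H G
| im_contract (G : sgraph) (x y : G) :
    sedge x y -> induced_minor H (contract_edge x y) -> induced_minor H G.

Definition consecutive (T : eqType) (p : seq T) (x y : T) : bool :=
  infix [:: x; y] p || infix [:: y; x] p.

(* ps lists the components of H \ {u}, each one as the sequence of its vertices
   along the path. *)
Definition path_components (H : sgraph) (u : H) (ps : seq (seq H)) : Prop :=
  [/\ [::] \notin ps,
      uniq (flatten ps),
      forall x, (x \in flatten ps) = (x != u)
    & forall x y, x != u -> y != u ->
        sedge x y = has (fun p => consecutive p x y) ps].

Definition petal (H : sgraph) (u : H) (p : seq H) : Prop :=
  (size p = 3 /\ forall x, x \in p -> sedge u x)
  \/ (forall x, x \in p -> sedge u x -> x = head u p \/ x = last u p).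

Definition flower (H : sgraph) : Prop :=
  exists (u : H) (ps : seq (seq H)),
    path_components u ps /\ forall p, p \in ps -> petal u p.

(* Random access machine with addition and truncated subtraction under unit
   cost.  There is no multiplication, so in t steps only numbers of at most
   O(t) bits more than the input and program constants can be produced, and
   polynomial time on this machine coincides with polynomial time on Turing
   machines (Cook and Reckhow, 1973). *)
Inductive instr :=
| Const (r c : nat)      (* R[r] := c *)
| Add (r s t : nat)      (* R[r] := R[s] + R[t] *)
| Sub (r s t : nat)      (* R[r] := R[s] - R[t] *)
| Read (r s : nat)       (* R[r] := M[R[s]] *)
| Write (r s : nat)      (* M[R[r]] := R[s] *)
| Jzero (r l : nat)      (* if R[r] = 0 then goto l *)
| Halt (b : bool).

Definition program := seq instr.

Record config := Config { pc : nat; regs : nat -> nat; memory : nat -> nat }.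

Definition upd (f : nat -> nat) (a v : nat) : nat -> nat :=
  fun i => if i == a then v else f i.

Definition set_reg (c : config) (r v : nat) : config :=
  Config (pc c).+1 (upd (regs c) r v) (memory c).

(* Outcome of at most t steps from c; None means that the machine is still
   running.  A program counter outside the program rejects. *)
Fixpoint exec (P : program) (t : nat) (c : config) : option bool :=
  if t is t'.+1 then
    let R := regs c in
    match nth (Halt false) P (pc c) with
    | Const r k => exec P t' (set_reg c r k)
    | Add r s q => exec P t' (set_reg c r (R s + R q))
    | Sub r s q => exec P t' (set_reg c r (R s - R q))
    | Read r s => exec P t' (set_reg c r (memory c (R s)))
    | Write r s =>
        exec P t' (Config (pc c).+1 R (upd (memory c) (R r) (R s)))
    | Jzero r l =>
        exec P t' (Config (if R r == 0 then l else (pc c).+1) R (memory c))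
    | Halt b => Some b
    end
  else None.

Definition adj_entry (G : sgraph) (i j : nat) : bool :=
  match insub i : option 'I_#|G|, insub j : option 'I_#|G| with
  | Some i', Some j' => sedge (enum_val i') (enum_val j')
  | _, _ => false
  end.

(* M[0] is the number n of vertices and M[1 + i * n + j] the entry (i, j) of
   the adjacency matrix; all other cells contain 0. *)
Definition encode (G : sgraph) : nat -> nat := fun a =>
  if a is k.+1 then nat_of_bool (adj_entry G (k %/ #|G|) (k %% #|G|))
  else #|G|.

Definition init (G : sgraph) : config := Config 0 (fun=> 0) (encode G).

Definition poly_time_decidable (Q : sgraph -> Prop) : Prop :=
  exists (P : program) (c k : nat), forall G : sgraph,
    exists2 b : bool,
      exec P (c * gsize G ^ k + c) (init G) = Some b & (b <-> Q G).

(* Main.v *)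
(** An induced minor model of a flower H in G can be normalized so that every
    bag except that of the center u is a single vertex.  Treat the petals one
    by one.  If u sees only ends of the path, a shortest path in the union of
    the bags of the petal, running between the first and the last bag and
    starting or ending at a neighbour of the bag of u where one is required, is
    induced and has no other neighbour of that bag; all but |P| of its vertices
    are discarded or absorbed into the bag of u.  If u sees all three vertices
    of the path, take again a shortest path between the two end bags; after
    absorbing part of the middle bag, the bag of u has a neighbour x in the
    interior of that path, and then everything but x and its two neighbours on
    the path can be absorbed from both ends.

    Hence H is an induced minor of G iff there are vertices v x, for x <> u,
    inducing H \ u, and a component of G minus these vertices and minus the
    neighbours of the v x with x not adjacent to u, that is adjacent to every
    v x with x adjacent to u.  There are polynomially many choices of v, and
    this condition is a formula of a small logic with quantifiers over vertices
    and inductively defined sets, each formula of which is evaluated by a RAM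
    program in polynomial time. *)

From HB Require Import structures.
From mathcomp Require Import all_boot.
From mathcomp Require Import zify.
Require Import Defs.
Set Implicit Arguments.
Unset Strict Implicit.
Unset Printing Implicit Defensive.

(** * Models of induced minors *)

(** An edge may be mapped to a walk, possibly an empty one. Both directions of contraction use this:
    an edge inside a bag may collapse, and an edge of the contracted graph may need a detour through
    the removed vertex. *)
Lemma connect_homo (T T' : finType) (e : rel T) (e' : rel T') (g : T -> T') :
  (forall a b, e a b -> connect e' (g a) (g b)) ->
  forall a b, connect e a b -> connect e' (g a) (g b).
Proof.
move=> h a b /connectP[p + ->] {b}; elim: p a => [|c p IH] a /=; first by rewrite connect0.
by case/andP=> /h hac /IH; apply: connect_trans.
Qed.

Lemma card_neq (T : finType) (v : T) : #|{: {z : T | z != v}}| < #|T|.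
Proof.
rewrite card_sig (eq_card (_ : _ =i predC1 v)) // cardC1 ltn_predL.
by apply/card_gt0P; exists v.
Qed.

Section Connected.

Variable G : sgraph.

Definition radj (A : {set G}) : rel G := fun x y => [&& x \in A, y \in A & sedge x y].

Definition connected (A : {set G}) : Prop :=
  forall x y, x \in A -> y \in A -> connect (radj A) x y.

Definition touch (A B : {set G}) : bool :=
  [exists x in A, exists y in B, sedge x y].

Lemma touchP (A B : {set G}) :
  reflect (exists x y, [/\ x \in A, y \in B & sedge x y]) (touch A B).
Proof.
apply: (iffP exists_inP) => [[x xA /exists_inP[y yB e]]|[x [y [xA yB e]]]].
  by exists x, y.
by exists x => //; apply/exists_inP; exists y.
Qed.

Lemma radj_sym A : symmetric (radj A).
Proof. by move=> x y; rewrite /radj sedge_sym andbCA. Qed.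

Lemma connect_radj_sym A : connect_sym (radj A).
Proof. exact: sym_connect_sym (radj_sym A). Qed.

Lemma connect_radjS (A B : {set G}) x y : A \subset B ->
  connect (radj A) x y -> connect (radj B) x y.
Proof.
move=> /subsetP sAB; apply: (connect_homo (g := id)) => a b /and3P[aA bA e].
by apply: connect1; rewrite /radj !sAB.
Qed.

Lemma connected1 x : connected [set x].
Proof. by move=> a b /set1P-> /set1P->; apply: connect0. Qed.

End Connected.

(** Vertices of [G] in no bag are the deleted ones, and the equality on edges makes the minor
    induced. Nonemptiness is a separate clause because the empty set counts as [connected]. *)
Definition model (H G : sgraph) (B : H -> {set G}) : Prop :=
  [/\ forall x, B x != set0,
      forall x, connected (B x),
      forall x y w, w \in B x -> w \in B y -> x = y
    & forall x y, x != y -> sedge x y = touch (B x) (B y)].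

Section ModelsOfInducedMinors.

Variable H : sgraph.

Lemma iso_model (G : sgraph) : iso G H -> exists B : H -> {set G}, model B.
Proof.
move=> [f [g fK gK] fe]; exists (fun x => [set g x]); split.
- by move=> x; apply/set0Pn; exists (g x); rewrite inE.
- by move=> x; apply: connected1.
- by move=> x y w /set1P-> /set1P/(can_inj gK).
- move=> x y _; apply/idP/touchP => [e|[a [b [/set1P-> /set1P->]]]]; last by rewrite -fe !gK.
  by exists (g x), (g y); rewrite !inE !eqxx -fe !gK.
Qed.

Lemma del_model (G : sgraph) (v : G) (B : H -> {set del_vertex v}) :
  model B -> exists B' : H -> {set G}, model B'.
Proof.
move=> [ne cn dj ed]; exists (fun x => [set val z | z in B x]); split.
- by move=> x; have /set0Pn[w wx] := ne x; apply/set0Pn; exists (val w); apply: imset_f.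
- move=> x _ _ /imsetP[a ax ->] /imsetP[b bx ->].
  apply: (connect_homo (g := val)) (cn x a b ax bx) => c d /and3P[cx dx e].
  by apply: connect1; rewrite /radj !imset_f.
- move=> x y w /imsetP[a ax ->] /imsetP[b bx /val_inj eab].
  by apply: (dj _ _ a); rewrite // eab.
- move=> x y xy; rewrite ed //; apply/touchP/touchP.
    by move=> [a [b [ax bx e]]]; exists (val a), (val b); rewrite !imset_f.
  by move=> [_ [_ [/imsetP[a ax ->] /imsetP[b bx ->] e]]]; exists a, b.
Qed.

(** The new bags are the preimages of the old ones under the map [r] that identifies [v] with
    [u]. *)
Lemma contract_model (G : sgraph) (u v : G) (B : H -> {set contract_edge u v}) :
  sedge u v -> model B -> exists B' : H -> {set G}, model B'.
Proof.
move=> uv; have nuv : u != v by apply/eqP => e; rewrite e sedge_irrefl in uv.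
pose u' : contract_edge u v := exist _ u nuv.
pose r (w : G) : contract_edge u v := insubd u' w.
have rv w : val (r w) = if w == v then u else w.
  by rewrite val_insubd if_neg.
have rK z : r (val z) = z.
  by apply: val_inj; rewrite rv; case: eqP (valP z) => // ->; rewrite eqxx.
move=> [ne cn dj ed]; pose B' x := [set w | r w \in B x].
(* Only [v] differs from its representative, and the edge [uv] joins the two inside the preimage. *)
have lift x (a : contract_edge u v) b : a \in B x -> r b = a ->
    connect (radj (B' x)) b (val a).
  move=> ax eb; have [ebv|nbv] := eqVneq b v; last first.
    by rewrite -eb rv (negbTE nbv); apply: connect0.
  subst b; have ru : r u = r v by apply: val_inj; rewrite !rv eqxx (negbTE nuv).
  apply: connect1; rewrite -eb rv eqxx /radj !inE ru eb ax sedge_sym uv.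
  by [].
have back a b : sedge a b -> r a != r b -> sedge (r a) (r b).
  move=> e nr; rewrite /= /contract_rel nr !rv /=.
  case: (eqVneq a v) e => [->|_] e; case: (eqVneq b v) e => [->|_] e;
    rewrite ?eqxx ?e ?orbT //.
    by rewrite sedge_irrefl in e.
  by rewrite [sedge v a]sedge_sym e !orbT.
exists B'; split.
- move=> x; have /set0Pn[w wx] := ne x; apply/set0Pn; exists (val w).
  by rewrite inE rK.
- move=> x a b; rewrite !inE => ax bx.
  apply: connect_trans (lift _ _ _ ax erefl) _; rewrite connect_radj_sym.
  apply: connect_trans (lift _ _ _ bx erefl) _; rewrite connect_radj_sym.
  apply: (connect_homo (g := val)) (cn x _ _ ax bx) => c d /and3P[cx dx].
  case/andP=> _ /or3P[e|/andP[/eqP ec e]|/andP[/eqP ec e]].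
  + by apply: connect1; rewrite /radj !inE !rK cx dx.
  + have cu : c = u' by apply: val_inj.
    apply: (connect_trans (y := v)).
      rewrite connect_radj_sym; apply: lift => //; apply: val_inj.
      by rewrite rv eqxx ec.
    apply: connect1; rewrite /radj !inE rK dx e andbT.
    by rewrite (_ : r v = c) ?cx //; apply: val_inj; rewrite rv eqxx ec.
  + rewrite connect_radj_sym; apply: (connect_trans (y := v)).
      rewrite connect_radj_sym; apply: lift => //; apply: val_inj.
      by rewrite rv eqxx ec.
    apply: connect1; rewrite /radj !inE rK cx e andbT.
    by rewrite (_ : r v = d) ?dx //; apply: val_inj; rewrite rv eqxx ec.
- by move=> x y w; rewrite !inE; apply: dj.
- move=> x y xy; rewrite ed //; apply/touchP/touchP; last first.
    move=> [a [b [ax bx e]]]; rewrite !inE in ax bx.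
    exists (r a), (r b); split=> //; apply: back => //.
    by apply: contraNneq xy => eab; rewrite eab in ax; rewrite (dj _ _ _ ax bx).
  move=> [a [b [ax bx /andP[nab]]]].
  case/or3P=> [e|/andP[/eqP ea e]|/andP[/eqP eb e]].
  + by exists (val a), (val b); rewrite !inE !rK.
  + exists v, (val b); rewrite !inE rK bx e; split=> //.
    by rewrite (_ : r v = a) //; apply: val_inj; rewrite rv eqxx ea.
  + exists (val a), v; rewrite !inE rK ax sedge_sym e; split=> //.
    by rewrite (_ : r v = b) //; apply: val_inj; rewrite rv eqxx eb.
Qed.

Lemma induced_minor_model (G : sgraph) :
  induced_minor H G -> exists B : H -> {set G}, model B.
Proof.
elim=> {}G; first exact: iso_model.
  by move=> v _ [B]; apply: del_model.
by move=> u v uv _ [B]; apply: contract_model.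
Qed.

Lemma model_del (G : sgraph) (v : G) (B : H -> {set G}) :
  model B -> (forall x, v \notin B x) ->
  exists B' : H -> {set del_vertex v}, model B'.
Proof.
move=> [ne cn dj ed] hv.
have nv x w : w \in B x -> w != v by apply: contraTneq => ->.
exists (fun x => [set z | val z \in B x]); split.
- move=> x; have /set0Pn[w wx] := ne x; apply/set0Pn.
  by exists (exist _ w (nv _ _ wx)); rewrite inE.
- move=> x a b; rewrite !inE => ax bx; have := cn x _ _ ax bx.
  rewrite -{2}[a](valKd a) -{2}[b](valKd a).
  apply: connect_homo => c d /and3P[cx dx e]; apply: connect1.
  by rewrite /radj !inE /= /del_rel !insubdK ?cx ?dx ?e //; apply: nv; eassumption.
- by move=> x y w; rewrite !inE; apply: dj.
- move=> x y xy; rewrite ed //; apply/touchP/touchP.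
    move=> [a [b [ax bx e]]]; exists (exist _ a (nv _ _ ax)), (exist _ b (nv _ _ bx)).
    by rewrite !inE.
  by move=> [a [b [ax bx e]]]; rewrite !inE in ax bx; exists (val a), (val b).
Qed.

(** With both ends of the contracted edge in one bag, identifying them respects membership in every
    bag, so the restricted bags still form a model. *)
Lemma model_contract (G : sgraph) (u v : G) (B : H -> {set G}) x0 :
  sedge u v -> u \in B x0 -> v \in B x0 -> model B ->
  exists B' : H -> {set contract_edge u v}, model B'.
Proof.
move=> uv ux vx [ne cn dj ed].
have nuv : u != v by apply/eqP => e; rewrite e sedge_irrefl in uv.
pose u' : contract_edge u v := exist _ u nuv.
pose r (w : G) : contract_edge u v := insubd u' w.
have rv w : val (r w) = if w == v then u else w by rewrite val_insubd if_neg.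
have rB w x : (val (r w) \in B x) = (w \in B x).
  rewrite rv; case: eqP => // ->.
  by apply/idP/idP => h; [rewrite (dj _ _ _ h ux) | rewrite (dj _ _ _ h vx)].
have rK z : r (val z) = z.
  by apply: val_inj; rewrite rv; case: eqP (valP z) => // ->; rewrite eqxx.
have back a b : sedge a b -> r a != r b -> sedge (r a) (r b).
  move=> e nr; rewrite /= /contract_rel nr !rv /=.
  case: (eqVneq a v) e => [->|_] e; case: (eqVneq b v) e => [->|_] e;
    rewrite ?eqxx ?e ?orbT //.
    by rewrite sedge_irrefl in e.
  by rewrite [sedge v a]sedge_sym e !orbT.
exists (fun x => [set z | val z \in B x]); split.
- move=> x; have /set0Pn[w wx] := ne x; apply/set0Pn.
  by exists (r w); rewrite inE rB.
- move=> x a b; rewrite !inE => ax bx; have := cn x _ _ ax bx.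
  rewrite -{2}[a]rK -{2}[b]rK.
  apply: connect_homo => c d /and3P[cx dx e].
  have [->|nr] := eqVneq (r c) (r d); first exact: connect0.
  by apply: connect1; rewrite /radj !inE !rB cx dx back.
- by move=> x y w; rewrite !inE; apply: dj.
- move=> x y xy; rewrite ed //; apply/touchP/touchP.
    move=> [a [b [ax bx e]]]; exists (r a), (r b); rewrite !inE !rB ax bx.
    split=> //; apply: back => //; apply: contraNneq xy => eab.
    by rewrite -rB eab rB in ax; rewrite (dj _ _ _ ax bx).
  move=> [a [b []]]; rewrite !inE => ax bx /andP[nab].
  case/or3P=> [e|/andP[/eqP ea e]|/andP[/eqP eb e]].
  + by exists (val a), (val b).
  + by exists v, (val b); rewrite -rB rv eqxx -ea.
  + by exists (val a), v; rewrite sedge_sym -[v \in _]rB rv eqxx -eb.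
Qed.

(** Induction on the number of vertices: delete a vertex outside all bags, or contract an edge
    inside a bag with at least two vertices. If neither exists, the bags are singletons covering
    [G], and the model is an isomorphism. *)
Lemma model_induced_minor (G : sgraph) (B : H -> {set G}) :
  model B -> induced_minor H G.
Proof.
have [m] := ubnP #|G|; elim: m G B => // m IH G B hm hB.
have [ne cn dj ed] := hB.
have [/existsP[v /forallP hv]|] := boolP [exists v, [forall x, v \notin B x]].
  have [B' hB'] := model_del hB hv; apply: (im_del (v := v)); apply: IH hB'.
  exact: leq_trans (card_neq v) hm.
rewrite negb_exists => /forallP hall.
have cov v : exists x, v \in B x.
  by have := hall v; rewrite negb_forall => /existsP[x]; rewrite negbK; exists x.
have [/existsP[x]|] := boolP [exists x, 1 < #|B x|].
  (* The first edge of a walk between two distinct vertices of the bag is the one to contract. *)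
  case/card_gt1P=> a [b [ax bx nab]]; have /connectP[[|c p]] := cn x a b ax bx.
    by move=> _ e; rewrite e eqxx in nab.
  case/andP=> /and3P[_ cx e] _ _; have [B' hB'] := model_contract e ax cx hB.
  apply: (im_contract e); apply: IH hB'.
  exact: leq_trans (card_neq c) hm.
rewrite negb_exists => /forallP h1.
have single x a b : a \in B x -> b \in B x -> a = b.
  move=> ax bx; apply/eqP; apply: contraR (h1 x) => nab.
  by apply/card_gt1P; exists a, b.
pose f v := xchoose (cov v); have fB v : v \in B (f v) by exact: xchooseP (cov v).
have cov' x : exists v, v \in B x by apply/set0Pn.
pose g x := xchoose (cov' x); have gB x : g x \in B x by exact: xchooseP (cov' x).
apply: im_iso; exists f.
  exists g => [v|x]; first by apply: (single (f v)).
  by apply: (dj _ _ (g x)).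
move=> a b; have [eab|nab] := eqVneq (f a) (f b).
  by rewrite (single _ _ _ (fB b) (_ : a \in _)) -?eab // !sedge_irrefl.
rewrite ed //; apply/touchP/idP => [[c [d [ca db e]]]|e]; last by exists a, b.
by rewrite (single _ _ _ (fB a) ca) (single _ _ _ (fB b) db).
Qed.

End ModelsOfInducedMinors.

(** * Induced paths *)

Ltac arith :=
  repeat match goal with
  | H : is_true (leq _ _) |- _ => revert H
  | H : @eq nat _ _ |- _ => revert H
  | H : is_true (leq _ _ && leq _ _) |- _ => revert H
  | H : is_true (~~ (_ == _)) |- _ => revert H
  | H : is_true (_ || _) |- _ => revert H
  end; clear; intros; lia.

Lemma infix2P (T : eqType) (x0 x y : T) (p : seq T) :
  reflect (exists i, [/\ i.+1 < size p, x = nth x0 p i & y = nth x0 p i.+1])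
          (infix [:: x; y] p).
Proof.
apply: (iffP (@infixP T [:: x; y] p)) => [[s [s' ->]]|[i [hi -> ->]]].
  exists (size s); rewrite size_cat /=; split; first by arith.
    by rewrite nth_cat ltnn subnn.
  by rewrite nth_cat ltnNge leqnSn subSnn.
exists (take i p), (drop i.+2 p); rewrite /= -!drop_nth ?cat_take_drop //.
exact: ltnW.
Qed.

Lemma consecutive_nth (T : eqType) (x0 : T) (p : seq T) i j : uniq p ->
  i < size p -> j < size p ->
  consecutive p (nth x0 p i) (nth x0 p j) = (i.+1 == j) || (j.+1 == i).
Proof.
have half k l : uniq p -> k < size p -> l < size p ->
    infix [:: nth x0 p k; nth x0 p l] p = (k.+1 == l).
  move=> up hk hl; apply/(infix2P x0)/eqP => [[m [hm]]|e]; last by exists k; rewrite e.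
  by move=> /eqP + /eqP; rewrite !nth_uniq // 1?ltnW // => /eqP-> /eqP->.
by move=> up hi hj; rewrite /consecutive !half.
Qed.

Lemma consecutive_mem (T : eqType) (p : seq T) x y :
  consecutive p x y -> (x \in p) && (y \in p).
Proof.
by case/orP=> /infixP[s [s' ->]]; rewrite !mem_cat !inE !eqxx !orbT.
Qed.

Lemma uniq_flatten_inj (T : eqType) (ps : seq (seq T)) p p' x :
  uniq (flatten ps) -> p \in ps -> p' \in ps -> x \in p -> x \in p' -> p = p'.
Proof.
elim: ps => //= q ps IH; rewrite cat_uniq => /and3P[_ /hasPn dj ups].
rewrite !inE => /orP[/eqP->|pps] /orP[/eqP->|p'ps] xp xp' //; last exact: IH.
  by have := dj x; rewrite /= xp => /(_ _)/negP[] //; apply/flattenP; exists p'.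
by have := dj x; rewrite /= xp' => /(_ _)/negP[] //; apply/flattenP; exists p.
Qed.

Section Paths.

Variable (G : sgraph) (g : G).

Definition nb (A : {set G}) (x : G) : bool := [exists a in A, sedge a x].

Lemma nbP (A : {set G}) x : reflect (exists2 a, a \in A & sedge a x) (nb A x).
Proof. exact: exists_inP. Qed.

Lemma nbS (A B : {set G}) x : A \subset B -> nb A x -> nb B x.
Proof. by move=> /subsetP s /nbP[a aA e]; apply/nbP; exists a; rewrite ?s. Qed.

Lemma nbU (A B : {set G}) x : nb (A :|: B) x = nb A x || nb B x.
Proof.
apply/nbP/orP => [[a /setUP[aA|aB] e]|[|]].
- by left; apply/nbP; exists a.
- by right; apply/nbP; exists a.
- by move=> h; apply/nbP; apply: nbS h; apply: subsetUl.
- by move=> h; apply/nbP; apply: nbS h; apply: subsetUr.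
Qed.

Lemma connectedU1 (A : {set G}) x : connected A -> nb A x -> connected (x |: A).
Proof.
move=> cA /nbP[a aA e].
have sA : A \subset x |: A by apply: subsetUr.
have main y : y \in x |: A -> connect (radj (x |: A)) a y.
  case/setU1P=> [->|yA]; first by apply: connect1; rewrite /radj !inE aA eqxx orbT.
  by apply: connect_radjS sA _; apply: cA.
move=> y z /main hy /main hz; apply: connect_trans hz; by rewrite connect_radj_sym.
Qed.

(** Each vertex of the path is adjacent to what was absorbed before it. The premise on the head is
    void for an empty path, so that empty segments need no separate treatment. *)
Lemma connected_absorb (A : {set G}) (s : seq G) : connected A -> sorted (@sedge G) s ->
  (0 < size s -> nb A (head g s)) -> connected (A :|: [set w in s]).
Proof.
case: s => [|x s] cA; first by rewrite (_ : [set w in [::]] = set0) ?setU0 //; apply/setP.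
move=> + /(_ isT) /=; elim: s x A cA => [|y s IH] x A cA /=.
  by move=> _ h; rewrite setUC (_ : [set w in [:: x]] = [set x]);
     [exact: connectedU1|apply/setP=> w; rewrite !inE].
case/andP=> xy hs nx.
have -> : A :|: [set w in [:: x, y & s]] = (x |: A) :|: [set w in y :: s].
  by apply/setP=> w; rewrite !inE orbCA orbA.
apply: IH => //; first exact: connectedU1.
by apply/nbP; exists x; rewrite ?inE ?eqxx.
Qed.

Lemma connected_absorb_rev (A : {set G}) (s : seq G) : connected A -> sorted (@sedge G) s ->
  (0 < size s -> nb A (last g s)) -> connected (A :|: [set w in s]).
Proof.
move=> cA hs hl; have -> : [set w in s] = [set w in rev s].
  by apply/setP=> w; rewrite !inE mem_rev.
apply: connected_absorb => //.
  by rewrite rev_sorted (eq_sorted (e' := @sedge G)) // => x y; rewrite sedge_sym.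
by rewrite size_rev -nth0 => h; rewrite nth_rev // subn1 nth_last hl.
Qed.

Definition induced_path (w : seq G) : Prop :=
  uniq w /\ forall i j, i < size w -> j < size w ->
    sedge (nth g w i) (nth g w j) = (i.+1 == j) || (j.+1 == i).

Lemma induced_path_sorted w : induced_path w -> sorted (@sedge G) w.
Proof.
move=> [_ h]; apply/(sortedP g) => i hi; rewrite h ?eqxx //.
exact: ltnW.
Qed.

Lemma induced_path_take k w : induced_path w -> induced_path (take k w).
Proof.
move=> [u h]; split=> [|i j hi hj]; first exact: take_uniq.
have sz := size_take_min k w.
by rewrite !nth_take ?h //; arith.
Qed.

Lemma induced_path_drop k w : induced_path w -> induced_path (drop k w).
Proof.
move=> [u h]; split=> [|i j]; first exact: drop_uniq.
by rewrite size_drop => hi hj; rewrite !nth_drop h; arith.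
Qed.

(** A walk from [A0] to [A1] inside [U] with the fewest vertices has all these properties, since a
    chord, a repetition, a later visit to [A0] or an earlier visit to [A1] would shorten it. *)
Lemma shortest_path (U A0 A1 : {set G}) a0 a1 :
  a0 \in A0 -> a1 \in A1 -> a0 \in U -> connect (radj U) a0 a1 ->
  exists w, [/\ [/\ induced_path w, {subset w <= U} & 0 < size w],
    nth g w 0 \in A0, nth g w (size w).-1 \in A1,
    forall i, i < size w -> nth g w i \in A0 -> i = 0
    & forall i, i < size w -> nth g w i \in A1 -> i.+1 = size w].
Proof.
move=> h0 h1 hU /connectP[s ps es].
pose walk (w : seq G) := [&& all (mem U) w, sorted (@sedge G) w, 0 < size w,
  nth g w 0 \in A0 & nth g w (size w).-1 \in A1].
have ex : exists m, [exists t : m.-tuple G, walk t].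
  exists (size s).+1; apply/existsP; exists (in_tuple (a0 :: s)).
  rewrite /walk /= h0 nth_last /= -es h1 hU /= !andbT.
  elim: s a0 {h0 es} hU ps => //= c s IH a aU /andP[/and3P[_ cU e] /(IH _ cU)].
  by rewrite cU e.
case: (ex_minnP ex) => m /existsP[t /and5P[tU ts t0 tA0 tA1]] min.
have {}min (w : seq G) : walk w -> size t <= size w.
  by move=> hw; rewrite size_tuple; apply: min; apply/existsP; exists (in_tuple w).
have hts := (sortedP g ts).
have inU i : i < size t -> nth g t i \in U by move=> hi; apply: (allP tU); apply: mem_nth.
(* Omitting the positions from [i] to [j.-1] leaves a walk, so minimality forces [j = i]. This one
   fact excludes chords, repetitions and returns to [A0]. *)
have cut i j : i <= j -> j < size t ->
    (i = 0 -> nth g t j \in A0) -> (0 < i -> sedge (nth g t i.-1) (nth g t j)) -> j = i.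
  move=> ij jt hi0 hi; apply/eqP; rewrite eqn_leq ij andbT.
  pose w := take i t ++ drop j t.
  have szw : size w = i + (size t - j).
    by rewrite size_cat size_drop size_take_min; arith.
  suff /min : walk w by rewrite szw; arith.
  have nw k : nth g w k = if k < i then nth g t k else nth g t (j + (k - i)).
    rewrite nth_cat size_take_min (_ : minn i _ = i); last by arith.
    by case: ltnP => ki; [rewrite nth_take|rewrite nth_drop].
  apply/and5P; split.
  - apply/allP=> x; rewrite mem_cat => /orP[/mem_take|/mem_drop]; exact: (allP tU).
  - apply/(sortedP g) => k; rewrite szw !nw => hk.
    case: (ltnP k.+1 i) => h1'; first by rewrite ltnW // hts //; arith.
    case: (ltnP k i) => h2; last by rewrite (subSn h2) ?addnS hts //; arith.
    have -> : k = i.-1 by arith.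
    by rewrite (_ : j + _ = j); [apply: hi|]; arith.
  - by rewrite szw; arith.
  - by rewrite nw; case: posnP => // i0; rewrite sub0n addn0 hi0.
  - rewrite nw szw ifF; last by arith.
    by rewrite (_ : j + _ = (size t).-1) //; arith.
have chord i j : i < j -> j < size t -> sedge (nth g t i) (nth g t j) -> j = i.+1.
  by move=> ij jt e; apply: cut.
have dup i j : i < j -> j < size t -> nth g t i != nth g t j.
  move=> ij jt; apply/eqP => e.
  have : j = i; last by arith.
  apply: cut; rewrite -?e //; first exact: ltnW.
    by move=> i0; rewrite i0.
  by case: i ij {e} => //= i ij _; apply: hts; arith.
exists t; split=> //; first split=> //; first split.
- by apply/(uniqP g) => i j; rewrite !inE => hi hj e; case: (ltngtP i j) => // h;
    [have := dup _ _ h hj | have := dup _ _ h hi]; rewrite e eqxx.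
- move=> i j hi hj; apply/idP/idP => [e|/orP[/eqP e|/eqP e]]; last 2 first.
  + by rewrite -e in hj *; apply: hts.
  + by rewrite -e sedge_sym in hi *; apply: hts.
  case: (ltngtP i j) => h.
  + by rewrite (chord _ _ h hj e) eqxx.
  + by rewrite sedge_sym in e; rewrite (chord _ _ h hi e) eqxx orbT.
  + by rewrite h sedge_irrefl in e.
- by move=> x xt; apply: (allP tU).
- by move=> i hi hA; apply: cut.
- move=> i hi hA; have : walk (take i.+1 t).
    have sz : size (take i.+1 t) = i.+1 by rewrite size_take_min; arith.
    apply/and5P; rewrite sz !nth_take //; split=> //.
    + by apply/allP=> x /mem_take; apply: (allP tU).
    + exact: take_sorted.
  by move/min; rewrite size_take_min; arith.
Qed.

End Paths.

(** * Shrinking a petal *)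

Section Petal.

Variables (H G : sgraph) (g : G) (B : H -> {set G}) (u : H) (p : seq H).
Notation k := (size p).
Notation p_ i := (nth u p i).

Hypothesis modelB : model B.
Hypothesis p_gt0 : 0 < k.
Hypothesis p_uniq : uniq p.
Hypothesis p_u : u \notin p.
Hypothesis p_edge : forall i j, i < k -> j < k ->
  sedge (p_ i) (p_ j) = (i.+1 == j) || (j.+1 == i).

Definition territory : {set G} := [set w | has (fun x => w \in B x) p].
Notation U := territory.

Lemma territoryP w : reflect (exists2 i, i < k & w \in B (p_ i)) (w \in U).
Proof. by rewrite inE; apply: (iffP (has_nthP u)). Qed.

Lemma mem_territory i w : i < k -> w \in B (p_ i) -> w \in U.
Proof. by move=> hi hw; apply/territoryP; exists i. Qed.

Lemma center_neq i : i < k -> u != p_ i.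
Proof. by move=> hi; apply: contraNneq p_u => ->; apply: mem_nth. Qed.

Lemma center_territory w : w \in B u -> w \notin U.
Proof.
move=> wu; apply/territoryP => -[i hi wi]; have [_ _ dj _] := modelB.
by move/eqP: (center_neq hi); apply; apply: dj wu wi.
Qed.

Lemma level_inj i j w : i < k -> j < k -> w \in B (p_ i) -> w \in B (p_ j) -> i = j.
Proof.
move=> hi hj wi wj; have [_ _ dj _] := modelB.
by apply/eqP; rewrite -(nth_uniq u hi hj p_uniq) (dj _ _ _ wi wj).
Qed.

(** Call [i] the level of the vertices in the bag of [p_ i]. Along an edge the level rises by at
    most one, because [p] is an induced path and the model reflects edges. *)
Lemma level_edge i j v w : i < k -> j < k -> v \in B (p_ i) -> w \in B (p_ j) ->
  sedge v w -> j <= i.+1.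
Proof.
move=> hi hj vi wj e; have [_ _ _ ed] := modelB.
have [->|nij] := eqVneq i j; first exact: leqnSn.
have : sedge (p_ i) (p_ j).
  by rewrite ed ?nth_uniq //; apply/touchP; exists v, w.
by rewrite p_edge //; arith.
Qed.

Lemma nb_center i w : i < k -> w \in B (p_ i) -> nb (B u) w -> sedge u (p_ i).
Proof.
move=> hi wi /nbP[a au e]; have [_ _ _ ed] := modelB.
by rewrite ed ?center_neq //; apply/touchP; exists a, w.
Qed.

Lemma ex_nb_center i : i < k -> sedge u (p_ i) -> exists2 w, w \in B (p_ i) & nb (B u) w.
Proof.
have [_ _ _ ed] := modelB; move=> hi; rewrite ed ?center_neq //.
by move=> /touchP[a [w [au wi e]]]; exists w => //; apply/nbP; exists a.
Qed.

Lemma territory_connect i a b : i < k -> a \in B (p_ 0) -> b \in B (p_ i) ->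
  connect (radj U) a b.
Proof.
have [_ cn _ ed] := modelB.
have sub j : j < k -> B (p_ j) \subset U.
  by move=> hj; apply/subsetP => w; apply: mem_territory.
elim: i b => [|i IH] b hi a0 bi.
  by apply: connect_radjS (sub 0 hi) _; apply: cn.
have : sedge (p_ i) (p_ i.+1) by rewrite p_edge ?eqxx // ltnW.
rewrite ed; last by rewrite nth_uniq ?ltn_eqF // ltnW.
case/touchP=> v [w [vi wi e]].
apply: connect_trans (IH v (ltnW hi) a0 vi) _.
apply: (connect_trans (y := w)); last by apply: connect_radjS (sub _ hi) _; apply: cn.
by apply: connect1; rewrite /radj e !(mem_territory _ vi, mem_territory _ wi) // ltnW.
Qed.

(** The level is 0 at the start and rises by at most one per step. Hence a path that ends at level
    [k.-1] has at least [k] vertices. *)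
Lemma level_le w i j : induced_path g w -> {subset w <= U} -> nth g w 0 \in B (p_ 0) ->
  i < size w -> j < k -> nth g w i \in B (p_ j) -> j <= i.
Proof.
move=> [_ hw] wU w0; elim: i j => [|i IH] j hi hj wj.
  by rewrite (level_inj hj p_gt0 wj w0).
have /territoryP[l hl wl] := wU _ (mem_nth g (ltnW hi)).
apply: leq_trans (level_edge hl hj wl wj _) _; last by rewrite ltnS IH // ltnW.
by rewrite hw ?eqxx // ltnW.
Qed.

(* C replaces the bag of u and the i-th vertex of q the bag of p_ i. *)
Definition shrinking (q : seq G) (C : {set G}) : Prop :=
  [/\ size q = k /\ induced_path g q,
      connected C /\ B u \subset C,
      C \subset B u :|: U,
      forall w, w \in q -> (w \in U) && (w \notin C)
    & forall i, i < k -> nb C (nth g q i) = sedge u (p_ i)].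

(** The vertices where a path through the territory may start or stop: if [u] sees [p_ i], only
    those with a neighbour in the bag of [u]. *)
Definition ends i : {set G} :=
  [set w in B (p_ i) | sedge u (p_ i) ==> nb (B u) w].

Lemma ends_nonempty i : i < k -> exists a, a \in ends i.
Proof.
have [ne _ _ _] := modelB; move=> hi; have [e|ne'] := boolP (sedge u (p_ i)).
  by have [w wi nw] := ex_nb_center hi e; exists w; rewrite inE wi nw implybT.
by have /set0Pn[w wi] := ne (p_ i); exists w; rewrite inE wi (negbTE ne').
Qed.

Lemma petal_path : exists w,
  [/\ [/\ induced_path g w, {subset w <= U} & k <= size w],
    nth g w 0 \in ends 0, nth g w (size w).-1 \in ends k.-1,
    forall i, i < size w -> nth g w i \in ends 0 -> i = 0
    & forall i, i < size w -> nth g w i \in ends k.-1 -> i.+1 = size w].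
Proof.
have lk : k.-1 < k by rewrite prednK.
have [a a0] := ends_nonempty p_gt0; have [b b1] := ends_nonempty lk.
have aB : a \in B (p_ 0) by move: a0; rewrite inE => /andP[].
have bB : b \in B (p_ k.-1) by move: b1; rewrite inE => /andP[].
have [w [[ip wU w0] h0 h1 k0 k1]] := shortest_path g a0 b1 (mem_territory p_gt0 aB)
  (territory_connect lk aB bB).
exists w; split=> //; split=> //.
have B0 : nth g w 0 \in B (p_ 0) by move: h0; rewrite inE => /andP[].
have B1 : nth g w (size w).-1 \in B (p_ k.-1) by move: h1; rewrite inE => /andP[].
have hl : (size w).-1 < size w by rewrite prednK.
by have := level_le ip wU B0 hl lk B1; arith.
Qed.

Lemma not_mem_takedrop (T : eqType) (s : seq T) m x : uniq s ->
  x \in take m s -> x \in drop m s -> False.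
Proof.
by rewrite -{1}(cat_take_drop m s) cat_uniq => /and3P[_ /hasPn h _] xt /h; rewrite /= xt.
Qed.

(** If [u] does not see the last vertex of [p], the first [k] vertices of [w] are kept and the bag
    of [u] is unchanged. Otherwise the last [k] are kept, and the others are absorbed if [u] also
    sees the first vertex of [p], and discarded if not. *)
Lemma shrink_end_petal :
  (forall x, x \in p -> sedge u x -> x = head u p \/ x = last u p) ->
  exists q C, shrinking q C.
Proof.
move=> hp; have lk : k.-1 < k by rewrite prednK.
have [w [[ip wU kw] h0 h1 k0 k1]] := petal_path.
set m := size w in kw h1 k0 k1.
pose a0 := sedge u (p_ 0); pose a1 := sedge u (p_ k.-1).
have ue i : i < k -> sedge u (p_ i) = (i == 0) && a0 || (i.+1 == k) && a1.
  move=> hi; apply/idP/orP => [e|[/andP[/eqP-> //]|/andP[/eqP e]]]; last first.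
    by rewrite /a1 -e.
  have [] := hp _ (mem_nth u hi) e.
    rewrite -nth0 => /eqP; rewrite nth_uniq // => /eqP i0.
    by left; move: e; rewrite i0.
  rewrite -nth_last => /eqP; rewrite nth_uniq // => /eqP i0.
  by right; move: e; rewrite i0 prednK ?eqxx.
(* A vertex of [w] with a neighbour in the bag of [u] lies in [ends 0] or [ends k.-1], which [w]
   meets only at its two extremities. *)
have nbw i : i < m -> nb (B u) (nth g w i) = (i == 0) && a0 || (i.+1 == m) && a1.
  move=> hi; apply/idP/orP => [e|[/andP[/eqP-> s0]|/andP[/eqP i1 s1]]].
  - have /territoryP[j hj wj] := wU _ (mem_nth g hi).
    have uj := nb_center hj wj e; have := uj; rewrite ue //.
    case/orP=> /andP[/eqP ej s]; [left|right]; rewrite s andbT; apply/eqP.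
      by apply: k0 => //; rewrite inE -{1}ej wj e implybT.
    by apply: k1 => //; rewrite inE -{1}ej wj e implybT.
  - by move: h0; rewrite inE -/a0 s0 => /andP[].
  - by move: h1; rewrite inE -/a1 s1 -i1 => /andP[].
have wBu x : x \in w -> x \notin B u.
  by move=> xw; apply: contraL (wU _ xw); apply: center_territory.
have [_ cn _ _] := modelB; have [wuniq wedge] := ip.
case b1: (a1); last first.
  exists (take k w), (B u); split=> //.
  - by split; [rewrite size_take_min; arith|exact: induced_path_take].
  - exact: subsetUl.
  - by move=> x /mem_take xw; rewrite wU // wBu.
  - by move=> i hi; rewrite nth_take // nbw ?ue ?b1 ?andbF //; arith.
(* The prefix can be absorbed only if its first vertex has a neighbour in the bag of [u], that is,
   if [a0] holds. *)
pose s := if a0 then take (m - k) w else [::].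
have sw : {subset s <= w} by rewrite /s; case: (a0) => // x /mem_take.
exists (drop (m - k) w), (B u :|: [set x in s]); split=> //.
- by split; [rewrite size_drop; arith|exact: induced_path_drop].
- split; last exact: subsetUl.
  apply: (connected_absorb (g := g)) => //.
    rewrite /s; case: (a0) => //; exact: induced_path_sorted (induced_path_take _ ip).
  rewrite /s; case e0: (a0) => // hs; rewrite -nth0 nth_take ?nbw ?e0 //.
    by arith.
  by move: hs; rewrite size_take_min; arith.
- by rewrite setUS //; apply/subsetP=> x; rewrite inE => /sw /wU.
- move=> x xd; have xw := mem_drop xd; rewrite wU //= !inE negb_or wBu //=.
  rewrite /s; case: (a0) => //; apply/negP => xt; exact: (not_mem_takedrop wuniq xt xd).
move=> i hi; rewrite nth_drop nbU nbw ?ue ?b1 ?andbT; try arith.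
(* As [w] is induced, the absorbed prefix, when nonempty, is adjacent to the first kept vertex and
   to no other. *)
have -> : nb [set x in s] (nth g w (m - k + i)) = [&& a0, i == 0 & k < m].
  apply/nbP/and3P => [[x]|[s0 /eqP-> km]].
    rewrite inE /s; case: (a0) => // /(nthP g)[j]; rewrite size_take_min => hj.
    rewrite nth_take; last by arith.
    by move=> <-; rewrite wedge; try arith; move=> ?; split=> //; arith.
  exists (nth g w (m - k).-1); last by rewrite wedge; arith.
  rewrite inE /s s0; apply/(nthP g); exists (m - k).-1.
    by rewrite size_take_min -/m; arith.
  by rewrite nth_take //; arith.
by case: (a0); arith.
Qed.

(** The kept vertices are an interior vertex of [w] adjacent to an enlarged bag [C0] of [u] and its
    two neighbours on [w]. The segments of [w] on both sides are attached to the bag of [u] by the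
    extremities of [w], so they can be absorbed. *)
Lemma shrink_full_petal : k = 3 -> (forall x, x \in p -> sedge u x) ->
  exists q C, shrinking q C.
Proof.
move=> k3 hp; have [_ cn _ _] := modelB.
have ue i : i < k -> sedge u (p_ i) by move=> hi; apply/hp/mem_nth.
have [w [[ip wU kw] h0 h1 _ _]] := petal_path.
set m := size w in kw h1; have [wuniq wedge] := ip.
move: h0 h1; rewrite k3 /= !inE !ue ?k3 //= => /andP[w0 nw0] /andP[wm nwm].
have l0 : 0 < k by rewrite k3.
have l1 : 1 < k by rewrite k3.
have l2 : 2 < k by rewrite k3.
have m3 : 3 <= m by rewrite -k3.
have wBu x : x \in w -> x \notin B u.
  by move=> xw; apply: contraL (wU _ xw); apply: center_territory.
have inner i : i < m -> nth g w i \in B (p_ 1) -> (0 < i) && (i.+1 < m).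
  move=> hi wi; have [i0|i_gt0] := posnP i.
    by rewrite i0 in wi; have := level_inj l1 l0 wi w0.
  rewrite /= ltn_neqAle hi andbT; apply/eqP => im.
  by rewrite -im in wm; have := level_inj l1 l2 wi wm.
(* Some vertex of w lies in the middle bag: levels start at 0, end at 2 and
   change by at most one along an edge. *)
have [j hj wj] : exists2 j, j < m & nth g w j \in B (p_ 1).
  have [/existsP[i wi]|no] := boolP [exists i : 'I_m, nth g w i \in B (p_ 1)].
    by exists i.
  have all0 i : i < m -> nth g w i \in B (p_ 0).
    elim: i => // i IH hi; have /IH wi := ltnW hi.
    have /territoryP[l hl wl] := wU _ (mem_nth g hi).
    have e : sedge (nth g w i) (nth g w i.+1) by rewrite wedge ?eqxx // ltnW.
    have := level_edge l0 hl wi wl e; rewrite leq_eqVlt ltnS leqn0 => /orP[] /eqP el.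
      rewrite el in wl; case/negP: no; apply/existsP; by exists (Ordinal hi).
    by rewrite el in wl.
  have mm : m.-1 < m by arith.
  by have := level_inj l0 l2 (all0 _ mm) wm.
(* A path inside the middle bag leads from a neighbour [b] of the bag of [u] to [w]. Its part before
   the first vertex on [w] is added to the bag of [u]; nothing is added if [b] is on [w]. The vertex
   of [w] so reached is interior by [inner]. *)
have [C0 [cC0 sBC CU wC [i [i_gt0 im nbi]]]] : exists C0 : {set G},
    [/\ connected C0, B u \subset C0, C0 \subset B u :|: U,
        forall x, x \in w -> x \notin C0
      & exists i, [/\ 0 < i, i.+1 < m & nb C0 (nth g w i)]].
  have [b bB nb_b] := ex_nb_center l1 (ue 1 l1).
  have [bw|nbw] := boolP (b \in w).
    exists (B u); split=> //; first exact: subsetUl.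
    have hb : index b w < m by rewrite index_mem.
    have := inner _ hb; rewrite nth_index // => /(_ bB)/andP[? ?].
    by exists (index b w); rewrite nth_index.
  have /connectP[s ps es] := cn (p_ 1) b _ bB wj.
  have sB x : x \in b :: s -> x \in B (p_ 1).
    elim: s b bB ps {es nb_b nbw} => [|c s IH] b bB /=; first by move=> _ /[!inE]/eqP->.
    case/andP=> /and3P[_ cB _] /(IH _ cB) h; rewrite inE => /orP[/eqP->//|]; exact: h.
  have hs : has (mem w) (b :: s).
    by apply/hasP; exists (nth g w j); [rewrite es mem_last|exact: mem_nth].
  set f := find (mem w) (b :: s).
  have fs : f < size (b :: s) by rewrite -has_find.
  have f0 : 0 < f by rewrite /f /= (negbTE nbw).
  have fw : nth g (b :: s) f \in w by apply: nth_find.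
  have srt : sorted (@sedge G) (b :: s).
    by apply: sub_path ps => x y /and3P[].
  pose t := take f (b :: s).
  have tw x : x \in t -> x \notin w.
    move=> /(nthP g)[l]; rewrite size_take_min => hl <-.
    have lf : l < f by arith.
    by rewrite nth_take //; apply: negbT; apply: before_find lf.
  have tB x : x \in t -> x \in B (p_ 1) by move=> /mem_take; apply: sB.
  clearbody f; exists (B u :|: [set x in t]); split.
  - apply: (connected_absorb (g := g)) => //; first exact: take_sorted.
    by move=> _; rewrite -nth0 nth_take.
  - exact: subsetUl.
  - by rewrite setUS //; apply/subsetP => x; rewrite inE => /tB; apply: mem_territory.
  - move=> x xw; rewrite !inE negb_or wBu //=.
    by apply/negP => /tw; rewrite xw.
  have hi : index (nth g (b :: s) f) w < m by rewrite index_mem.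
  have := inner _ hi; rewrite nth_index // => /(_ (sB _ (mem_nth g fs)))/andP[? ?].
  exists (index (nth g (b :: s) f) w); rewrite nth_index //; split=> //.
  apply/nbP; exists (nth g (b :: s) f.-1).
    rewrite !inE; apply/orP; right; apply/(nthP g); exists f.-1.
      by rewrite size_take_min leq_min prednK // leqnn ltnW.
    by rewrite nth_take //; arith.
  by have := sortedP g srt f.-1; rewrite prednK //; apply.
pose s1 := take i.-1 w; pose s2 := drop i.+2 w.
pose q := take 3 (drop i.-1 w).
have sw1 x : x \in s1 -> x \in w by move=> /mem_take.
have sw2 x : x \in s2 -> x \in w by move=> /mem_drop.
have szq : size q = 3 by rewrite size_take_min size_drop -/m; arith.
have nq l : l < 3 -> nth g q l = nth g w (i.-1 + l).
  by move=> hl; rewrite nth_take // nth_drop.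
exists q, (C0 :|: [set x in s1] :|: [set x in s2]); split.
- by rewrite szq; split=> //; apply/induced_path_take/induced_path_drop.
- split.
    apply: (connected_absorb_rev (g := g)); first apply: (connected_absorb (g := g)) => //.
    + exact: induced_path_sorted (induced_path_take _ ip).
    + rewrite size_take_min => hs; rewrite -nth0 nth_take; last by arith.
      exact: nbS sBC nw0.
    + exact: induced_path_sorted (induced_path_drop _ ip).
    + rewrite size_drop -nth_last nth_drop size_drop -/m => hs.
      rewrite (_ : _ + _ = m.-1); last by arith.
      by apply: nbS nwm; apply: subset_trans sBC _; apply: subsetUl.
  by apply: subset_trans sBC _; rewrite -setUA subsetUl.
- rewrite !subUset CU /=; apply/andP; split; apply/subsetP => x; rewrite !inE.
    by move=> /sw1 /wU; rewrite inE => ->; rewrite orbT.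
  by move=> /sw2 /wU; rewrite inE => ->; rewrite orbT.
- move=> x /(nthP g)[l]; rewrite szq => hl <-; rewrite nq //.
  have xw : nth g w (i.-1 + l) \in w by apply: mem_nth; rewrite -/m; arith.
  rewrite wU // !inE !negb_or wC //=; apply/andP; split; apply/negP => /(nthP g)[l'].
    rewrite size_take_min => hl'; rewrite nth_take; last by arith.
    by move=> /eqP; rewrite nth_uniq // -/m; arith.
  rewrite size_drop -/m => hl'; rewrite nth_drop => /eqP.
  by rewrite nth_uniq // -/m; arith.
move=> l hl; rewrite ue // nq -?k3 // !nbU.
have : [|| l == 0, l == 1 | l == 2] by arith.
(* An outer kept vertex is adjacent to the absorbed segment on its side, or, if that segment is
   empty, is an extremity of [w] and hence adjacent to the old bag of [u]. *)
case/or3P=> /eqP->.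
- have [i1|i1] := posnP i.-1.
    by rewrite i1 (nbS sBC nw0).
  apply/orP; left; apply/orP; right; apply/nbP; exists (nth g w i.-2).
    rewrite inE; apply/(nthP g); exists i.-2; first by rewrite size_take_min -/m; arith.
    by rewrite nth_take //; arith.
  by rewrite wedge -/m; arith.
- by rewrite (_ : _ + 1 = i) ?nbi //; arith.
- rewrite (_ : _ + 2 = i.+1); last by arith.
  have [im'|im'] := eqVneq i.+2 m.
    by rewrite -[i.+1]/(i.+2.-1) im' (nbS sBC nwm).
  apply/orP; right; apply/nbP; exists (nth g w i.+2).
    rewrite inE; apply/(nthP g); exists 0; first by rewrite size_drop -/m; arith.
    by rewrite nth_drop addn0.
  by rewrite wedge -/m; arith.
Qed.

End Petal.

(** * Shrinking all petals of a flower *)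

Lemma touch_sym (G : sgraph) (A B : {set G}) : touch A B = touch B A.
Proof.
by apply/touchP/touchP => -[x [y [xA yB e]]]; exists y, x; rewrite sedge_sym.
Qed.

Lemma touch1 (G : sgraph) (A : {set G}) x : touch A [set x] = nb A x.
Proof.
apply/touchP/nbP => [[a [b [aA /set1P-> e]]]|[a aA e]]; first by exists a.
by exists a, x; rewrite inE.
Qed.

(** The bags outside [p] and [u] are unaffected: the bag of [u] grows only by vertices of the
    territory of [p], and these have no neighbour in such a bag, since [H] has no edge there. *)
Lemma shrinking_model (H G : sgraph) (g : G) (B : H -> {set G}) u p q C :
  model B -> uniq p -> u \notin p ->
  (forall i j, i < size p -> j < size p ->
     sedge (nth u p i) (nth u p j) = (i.+1 == j) || (j.+1 == i)) ->
  (forall x y, x \in p -> y \notin p -> y != u -> ~~ sedge x y) ->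
  shrinking g B u p q C ->
  model (fun x => if x == u then C else
                  if x \in p then [set nth g q (index x p)] else B x).
Proof.
move=> mB up unp pe pout [[sq [uq eq]] [cC sBC] CU qU nbC].
have [ne cn dj ed] := mB; pose U := territory B p.
set B' := fun x => _; pose v x := nth g q (index x p).
have Bu : B' u = C by rewrite /B' eqxx.
have pu x : x \in p -> x != u by apply: contraTneq => ->.
have Bp x : x \in p -> B' x = [set v x].
  by move=> xp; rewrite /B' (negbTE (pu _ xp)) xp.
have Bo x : x != u -> x \notin p -> B' x = B x.
  by rewrite /B' => /negbTE-> /negbTE->.
have vq x : x \in p -> v x \in q by move=> xp; rewrite mem_nth // sq index_mem.
have far a w y : a \in U -> w \in B y -> y != u -> y \notin p -> ~~ sedge a w.
  move=> /(territoryP _ u)[i hi ai] wy yu yp; apply/negP => e.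
  have ip := mem_nth u hi; have /negP[] := pout _ _ ip yp yu.
  rewrite ed; first by apply/touchP; exists a, w.
  by apply: contraNneq yp => <-.
have other w y : w \in B y -> y != u -> y \notin p -> w \notin C /\ w \notin U.
  move=> wy yu yp; have wU : w \notin U.
    apply/negP => /(territoryP _ u)[i hi wi].
    by move: yp; rewrite (dj _ _ _ wy wi) mem_nth.
  split=> //; apply/negP => /(subsetP CU); rewrite inE (negbTE wU) orbF => wu.
  by move: yu; rewrite (dj _ _ _ wy wu) eqxx.
have cls x : [\/ x = u, x \in p | (x != u) && (x \notin p)].
  have [->|xu] := eqVneq x u; first by constructor 1.
  by have [xp|xp] := boolP (x \in p); [constructor 2|constructor 3].
split.
- move=> x; case: (cls x) => [->|xp|/andP[xu xp]].
  + rewrite Bu; have /set0Pn[w wu] := ne u; apply/set0Pn; exists w.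
    exact: (subsetP sBC).
  + by rewrite Bp //; apply/set0Pn; exists (v x); rewrite inE.
  + by rewrite Bo.
- move=> x; case: (cls x) => [->|xp|/andP[xu xp]].
  + by rewrite Bu.
  + by rewrite Bp //; apply: connected1.
  + by rewrite Bo.
- have vU x : x \in p -> v x \in U by move=> /vq /qU /andP[].
  have vC x : x \in p -> v x \notin C by move=> /vq /qU /andP[].
  move=> x y w; case: (cls x) => [->|xp|/andP[xu xp]];
    case: (cls y) => [->|yp|/andP[yu yp]];
    rewrite ?Bu ?(Bp _ xp) ?(Bp _ yp) ?(Bo _ xu xp) ?(Bo _ yu yp) //.
  + by move=> wC /set1P ew; have := vC _ yp; rewrite -ew wC.
  + by move=> wC wy; have [] := other _ _ wy yu yp; rewrite wC.
  + by move=> /set1P ew wC; have := vC _ xp; rewrite -ew wC.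
  + move=> /set1P-> /set1P/eqP; rewrite nth_uniq ?sq ?index_mem // => /eqP ei.
    by rewrite -(nth_index u xp) ei nth_index.
  + by move=> /set1P ew wy; have [_] := other _ _ wy yu yp; rewrite ew vU.
  + by move=> wx wC; have [] := other _ _ wx xu xp; rewrite wC.
  + by move=> wx /set1P ew; have [_] := other _ _ wx xu xp; rewrite ew vU.
  + exact: dj.
have vU x : x \in p -> v x \in U by move=> /vq /qU /andP[].
have Eup y : y \in p -> sedge u y = touch C [set v y].
  by move=> yp; rewrite touch1 nbC ?index_mem // nth_index.
have Euo y : y != u -> y \notin p -> sedge u y = touch C (B y).
  move=> yu yp; rewrite ed 1?eq_sym //; apply/touchP/touchP => -[a [w [aC wy e]]].
    by exists a, w; split=> //; apply: (subsetP sBC).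
  exists a, w; split=> //; have /setUP[//|aU] := subsetP CU _ aC.
  by have := far _ _ _ aU wy yu yp; rewrite e.
have Epo x y : x \in p -> y != u -> y \notin p -> sedge x y = touch [set v x] (B y).
  move=> xp yu yp; rewrite (negbTE (pout _ _ xp yp yu)).
  apply/esym/touchP => -[a [w [/set1P-> wy e]]].
  by have := far _ _ _ (vU _ xp) wy yu yp; rewrite e.
move=> x y; case: (cls x) => [->|xp|/andP[xu xp]];
  case: (cls y) => [->|yp|/andP[yu yp]];
  rewrite ?Bu ?(Bp _ xp) ?(Bp _ yp) ?(Bo _ xu xp) ?(Bo _ yu yp) ?eqxx // => xy.
- exact: Eup.
- exact: Euo.
- by rewrite sedge_sym touch_sym Eup.
- rewrite touch1 -{1}(nth_index u xp) -{1}(nth_index u yp) pe ?index_mem //.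
  rewrite -eq ?sq ?index_mem //; apply/idP/nbP => [e|[a /set1P-> //]].
  by exists (v x); rewrite ?inE.
- exact: Epo.
- by rewrite sedge_sym touch_sym Euo.
- by rewrite sedge_sym touch_sym Epo.
- exact: ed.
Qed.

(** The petals are shrunk one after the other. Shrinking changes only the bags of [u] and of the
    current petal, so bags already reduced to one vertex stay so. *)
Lemma flower_model (H G : sgraph) (B : H -> {set G}) u ps :
  path_components u ps -> (forall p, p \in ps -> petal u p) -> model B ->
  exists2 B' : H -> {set G}, model B' & forall x, x != u -> exists v, B' x = [set v].
Proof.
move=> [ps0 ups cov ed] hps mB.
suff [B' mB' hB'] : exists2 B' : H -> {set G}, model B' &
    forall p x, p \in ps -> x \in p -> exists v, B' x = [set v].
  exists B' => // x; rewrite -cov => /flattenP[p pps xp]; exact: hB' pps xp.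
have sub : {subset ps <= ps} by [].
(* The induction runs over an arbitrary list of members of [ps], while the facts about [ps] itself
   remain available. *)
elim: {-2}ps sub => [|p qs IH] sub; first by exists B.
have [|B1 mB1 hB1] := IH; first by move=> q qq; apply: sub; rewrite inE qq orbT.
have pps : p \in ps by apply: sub; rewrite inE eqxx.
have xps x : x \in p -> x != u by move=> xp; rewrite -cov; apply/flattenP; exists p.
have p_gt0 : 0 < size p by case: (p) pps => // h; rewrite h in ps0.
have up : uniq p.
  have := ups; rewrite (perm_uniq (perm_flatten (perm_to_rem pps))) /=.
  by rewrite cat_uniq => /and3P[].
have unp : u \notin p by apply/negP => /xps; rewrite eqxx.
have pe i j : i < size p -> j < size p ->
    sedge (nth u p i) (nth u p j) = (i.+1 == j) || (j.+1 == i).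
  move=> hi hj; rewrite -(consecutive_nth u up hi hj).
  rewrite ed ?xps ?mem_nth //; apply/hasP/idP => [[q qps cq]|cp]; last by exists p.
  have /andP[iq _] := consecutive_mem cq.
  by rewrite {1}(uniq_flatten_inj ups pps qps (mem_nth u hi) iq).
have pout x y : x \in p -> y \notin p -> y != u -> ~~ sedge x y.
  move=> xp yp yu; rewrite (ed _ _ (xps _ xp) yu); apply/hasPn => q qps; apply/negP.
  move=> /consecutive_mem/andP[xq yq].
  by rewrite (uniq_flatten_inj ups pps qps xp xq) yq in yp.
have [ne _ _ _] := mB1; have /set0Pn[g _] := ne u.
have [q [C hqC]] : exists q C, shrinking g B1 u p q C.
  case: (hps _ pps) => [[k3 full]|ends].
    exact: shrink_full_petal.
  exact: shrink_end_petal.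
have mB2 := shrinking_model mB1 up unp pe pout hqC.
eexists; first exact: mB2.
move=> p' x; rewrite inE => /orP[/eqP->|p'qs] xp /=.
  by rewrite (negbTE (xps _ xp)) xp; eexists.
have [v hv] := hB1 _ _ p'qs xp.
have xu : x != u.
  rewrite -cov; apply/flattenP; exists p' => //.
  by apply: sub; rewrite inE p'qs orbT.
by rewrite (negbTE xu) hv; case: ifP; eexists.
Qed.

(** * From normalized models to vertex maps *)

Section Witness.

Variables (H G : sgraph) (u : H) (v : H -> G).

(* The vertices that may be put into the bag of the center once the bag of
   every other vertex x is {v x}. *)
Definition allowed : {set G} :=
  [set w | [forall x, (x != u) ==>
     (w != v x) && (~~ sedge u x ==> ~~ sedge (v x) w)]].

Lemma allowedP w : reflect (forall x, x != u ->
    w != v x /\ (~~ sedge u x -> ~~ sedge (v x) w)) (w \in allowed).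
Proof.
rewrite inE; apply: (iffP 'forall_implyP) => h x xu.
  by have /andP[-> /implyP] := h x xu.
by have [-> /implyP] := h x xu.
Qed.

(** The vertex [v u] only names a component of the allowed vertices, which serves as the bag of the
    center. *)
Definition witness : Prop :=
  [/\ forall x y, x != u -> y != u -> x != y ->
         v x != v y /\ sedge (v x) (v y) = sedge x y,
      v u \in allowed
    & forall x, sedge u x ->
        exists2 w, connect (radj allowed) (v u) w & sedge (v x) w].

(** The bag of [u] is the whole component of [v u]. It has no edge to [v x] when [x] is not adjacent
    to [u], because [allowed] excludes the neighbours of such [v x]. *)
Lemma witness_model : witness -> exists B : H -> {set G}, model B.
Proof.
move=> [vP uA hu]; pose C := [set w | connect (radj allowed) (v u) w].
have uC : v u \in C by rewrite inE connect0.
have CA w : w \in C -> w \in allowed.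
  rewrite inE => /connectP[p]; elim/last_ind: p w => [|p c _] w /=; first by move=> _ ->.
  by rewrite rcons_path last_rcons => /andP[_ /and3P[_ cA _]] ->.
have cC : connected C.
  (* A walk from [v u] visits only vertices reachable from [v u], so it stays in [C]. *)
  have main w : connect (radj allowed) (v u) w -> connect (radj C) (v u) w.
    case/connectP=> p; elim/last_ind: p w => [|p c IH] w /=; first by move=> _ ->.
    rewrite rcons_path last_rcons => /andP[hp e] ->.
    apply: connect_trans (IH _ hp erefl) _; apply: connect1.
    have lC : last (v u) p \in C by rewrite inE; apply/connectP; exists p.
    rewrite /radj lC !inE; case/and3P: (e) => _ _ ->; rewrite andbT.
    by rewrite inE in lC; apply: connect_trans lC (connect1 e).
  move=> a b; rewrite !inE => /main ha /main; apply: connect_trans.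
  by rewrite connect_radj_sym.
pose B x := if x == u then C else [set v x].
have Bu : B u = C by rewrite /B eqxx.
have Bx x : x != u -> B x = [set v x] by rewrite /B => /negbTE->.
have vC x : x != u -> v x \notin C.
  by move=> xu; apply/negP => /CA /allowedP/(_ _ xu)[]; rewrite eqxx.
have Eu x : x != u -> sedge u x = touch C [set v x].
  move=> xu; rewrite touch1; apply/idP/nbP => [/hu[w cw e]|[w wC e]].
    by exists w; rewrite ?inE // sedge_sym.
  have [_ h] := allowedP _ (CA _ wC) _ xu.
  by apply: contraLR e => /h; rewrite sedge_sym.
exists B; split.
- move=> x; apply/set0Pn; exists (v x); have [->|xu] := eqVneq x u; first by rewrite Bu.
  by rewrite Bx ?inE.
- by move=> x; rewrite /B; case: eqP => // _; apply: connected1.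
- move=> x y w; have [->|xu] := eqVneq x u; have [->|yu] := eqVneq y u;
    rewrite ?Bu ?(Bx x) ?(Bx y) //.
  + by move=> wC /set1P e; have := vC _ yu; rewrite -e wC.
  + by move=> /set1P e wC; have := vC _ xu; rewrite -e wC.
  + move=> /set1P-> /set1P e; apply/eqP; apply: contraT => xy.
    by have [] := vP _ _ xu yu xy; rewrite e eqxx.
- move=> x y; have [->|xu] := eqVneq x u; have [->|yu] := eqVneq y u;
    rewrite ?Bu ?(Bx x) ?(Bx y) ?eqxx // => xy.
  + exact: Eu.
  + by rewrite sedge_sym touch_sym Eu.
  + have [_ <-] := vP _ _ xu yu xy; rewrite touch1.
    by apply/idP/nbP => [e|[a /set1P-> //]]; exists (v x); rewrite ?inE.
Qed.

End Witness.

(** The bag of [u] is connected and consists of allowed vertices, so it lies in the component of any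
    of its vertices; one of them is taken as [v u]. *)
Lemma model_witness (H G : sgraph) (u : H) (B : H -> {set G}) : model B ->
  (forall x, x != u -> exists v, B x = [set v]) -> exists v : H -> G, witness u v.
Proof.
move=> [ne cn dj ed] hs; have exB x : exists v, v \in B x by apply/set0Pn.
pose v x := xchoose (exB x); have vB x : v x \in B x by exact: xchooseP (exB x).
have Bx x : x != u -> B x = [set v x].
  by move=> xu; have [w e] := hs x xu; have := vB x; rewrite e => /set1P->.
have uA w : w \in B u -> w \in allowed u v.
  move=> wu; apply/allowedP => x xu; split.
    by apply: contraNneq xu => e; rewrite e in wu; rewrite (dj _ _ _ (vB x) wu).
  rewrite ed 1?eq_sym //; apply: contra => e; apply/touchP.
  by exists w, (v x); rewrite sedge_sym.
exists v; split.
- move=> x y xu yu xy; split.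
    by apply: contraNneq xy => e; have := vB x; rewrite e => /dj/(_ (vB y))->.
  rewrite ed // (Bx _ xu) (Bx _ yu) touch1.
  by apply/idP/nbP => [e|[a /set1P-> //]]; exists (v x); rewrite ?inE.
- exact: uA.
- move=> x ux; have xu : x != u by apply: contraTneq ux => ->; rewrite sedge_irrefl.
  move: ux; rewrite ed 1?eq_sym // (Bx _ xu) => /touchP[w [a [wu /set1P-> e]]].
  exists w; last by rewrite sedge_sym.
  apply: connect_radjS (cn u _ _ (vB u) wu).
  by apply/subsetP.
Qed.

Lemma flower_witness (H G : sgraph) (u : H) ps :
  path_components u ps -> (forall p, p \in ps -> petal u p) ->
  induced_minor H G <-> exists v : H -> G, witness u v.
Proof.
move=> hps hpet; split=> [/induced_minor_model[B mB]|[v /witness_model[B mB]]].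
  by have [B' mB' hB'] := flower_model hps hpet mB; apply: model_witness hB'.
exact: model_induced_minor mB.
Qed.

(** * A Hoare logic for the random access machine *)

Notation store := (nat -> nat).

Definition code_at (P : program) (l : nat) (c : program) : Prop :=
  forall i, i < size c -> nth (Halt false) P (l + i) = nth (Halt false) c i.

Lemma code_at_cat P l c1 c2 : code_at P l (c1 ++ c2) ->
  code_at P l c1 /\ code_at P (l + size c1) c2.
Proof.
move=> h; split=> i hi.
  by rewrite h ?nth_cat ?hi // size_cat ltn_addr.
by rewrite -addnA h ?size_cat ?ltn_add2l // nth_cat ltnNge leq_addr addKn.
Qed.

(* Code depends on the address at which it is loaded, since jumps are absolute. *)
Definition code := nat -> program.

(** Total correctness with a time bound: the code always leaves at its end. The remaining fuel [k]
    is arbitrary, which makes triples compose. *)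
Definition triple (c : code) (T : nat) (Pre Post : store -> store -> Prop) : Prop :=
  forall P l R M, code_at P l (c l) -> Pre R M ->
  exists t R' M', [/\ t <= T, Post R' M' &
    forall k, exec P (t + k) (Config l R M) =
              exec P k (Config (l + size (c l)) R' M')].

Definition straight (i : instr) : bool :=
  if i is (Jzero _ _ | Halt _) then false else true.

Definition effect (s : store * store) (i : instr) : store * store :=
  let: (R, M) := s in
  match i with
  | Const r k => (upd R r k, M)
  | Add r a b => (upd R r (R a + R b), M)
  | Sub r a b => (upd R r (R a - R b), M)
  | Read r a => (upd R r (M (R a)), M)
  | Write r a => (R, upd M (R r) (R a))
  | _ => s
  end.

Lemma triple_block (c : program) (Pre Post : store -> store -> Prop) :
  all straight c ->
  (forall R M, Pre R M -> let s := foldl effect (R, M) c in Post s.1 s.2) ->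
  triple (fun=> c) (size c) Pre Post.
Proof.
move=> sc hc P l R M hP /hc {hc}; case E: (foldl _ _ _) => [R' M'] /= hpost.
exists (size c), R', M'; split=> // k; elim: c l R M sc hP E {hpost} => [|i c IH] l R M /=.
  by move=> _ _ [<- <-]; rewrite addn0.
case/andP=> si sc hP; have hi := hP 0 isT; rewrite addn0 /= in hi.
have hP' : code_at P l.+1 c by move=> j hj; have := hP j.+1 hj; rewrite addnS.
move=> hs; rewrite hi addnS -addSn; case: i si hi hs {hP} => //= *; exact: IH.
Qed.

Lemma triple_weaken c T T' (Pre Pre' Post Post' : store -> store -> Prop) :
  triple c T Pre Post -> T <= T' ->
  (forall R M, Pre' R M -> Pre R M) -> (forall R M, Post R M -> Post' R M) ->
  triple c T' Pre' Post'.
Proof.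
move=> h lT hpre hpost P l R M hc /hpre hp.
have [t [R' [M' [ht hQ he]]]] := h P l R M hc hp.
by exists t, R', M'; split=> //; [exact: leq_trans lT | exact: hpost].
Qed.

Lemma triple_le c T T' Pre Post :
  triple c T Pre Post -> T <= T' -> triple c T' Pre Post.
Proof. by move=> h lT; apply: triple_weaken h lT _ _. Qed.

Lemma triple_pre c T (Pre Pre' Post : store -> store -> Prop) :
  triple c T Pre Post -> (forall R M, Pre' R M -> Pre R M) -> triple c T Pre' Post.
Proof. by move=> h hp; apply: triple_weaken h (leqnn T) hp _. Qed.

Definition cseq (c1 c2 : code) : code :=
  fun l => let p := c1 l in p ++ c2 (l + size p).

Lemma triple_seq c1 c2 T1 T2 Pre Mid Post :
  triple c1 T1 Pre Mid -> triple c2 T2 Mid Post ->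
  triple (cseq c1 c2) (T1 + T2) Pre Post.
Proof.
move=> h1 h2 P l R M /code_at_cat[k1 k2] hp.
have [t1 [R1 [M1 [l1 m1 e1]]]] := h1 _ _ _ _ k1 hp.
have [t2 [R2 [M2 [l2 m2 e2]]]] := h2 _ _ _ _ k2 m1.
exists (t1 + t2), R2, M2; split=> //; first exact: leq_add.
by move=> k; rewrite -addnA e1 e2 /cseq size_cat addnA.
Qed.

(* Runs the body with register i equal to 0, 1, ..., R[b] - 1; register 1 must
   contain 1 and register 0 is scratch. *)
Definition cfor (i b : nat) (body : code) : code := fun l =>
  let p := body (l + 3) in
  [:: Const i 0; Sub 0 b i; Jzero 0 (l + size p + 6)] ++ p ++
  [:: Add i i 1; Const 0 0; Jzero 0 l.+1].

(** The invariant must ignore register 0, which the test and the jump back overwrite. The 3 pays for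
    the initialization and the last test, the 5 for the test, increment and jump of each round. *)
Lemma triple_for i b body n T (I : nat -> store -> store -> Prop)
    (Pre : store -> store -> Prop) :
  i != 0 ->
  (forall k R M v, I k R M -> I k (upd R 0 v) M) ->
  (forall k R M, I k R M -> R i = k /\ R b = n) ->
  (forall R M, Pre R M -> I 0 (upd R i 0) M) ->
  (forall k, k < n -> triple body T (I k) (fun R M =>
     [/\ R 1 = 1, R i = k & I k.+1 (upd R i k.+1) M])) ->
  triple (cfor i b body) (3 + n * (T + 5)) Pre (I n).
Proof.
move=> i0 I0 Ii hpre hbody P l R M hc /hpre hI.
have [h1 /code_at_cat[h2 h3]] := code_at_cat hc.
have e0 := h1 0 isT; have e1 := h1 1 isT; have e2 := h1 2 isT.
have e3 := h3 0 isT; have e4 := h3 1 isT; have e5 := h3 2 isT.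
rewrite /= ?addn0 ?addn1 ?addn2 in e0 e1 e2 e3 e4 e5 h2.
set p := body (l + 3) in hc h2 h3 e2 e3 e4 e5 *.
have sz : size (cfor i b body l) = size p + 6.
  by rewrite /cfor /= size_cat /= -/p addnC; lia.
suff main : forall m k R M, k + m = n -> I k R M ->
    exists t R' M', [/\ t <= 2 + m * (T + 5), I n R' M' &
    forall q, exec P (t + q) (Config l.+1 R M) =
              exec P q (Config (l + size p + 6) R' M')].
  have [t [R' [M' [lt It et]]]] := main n 0 _ _ erefl hI.
  exists t.+1, R', M'; split=> //.
  by move=> q; rewrite sz addnA -et addSn /= e0.
elim=> [|m IH] k {hI}R {}M hk hI.
  have [Ri Rb] := Ii _ _ _ hI.
  exists 2, (upd R 0 0), M; split=> //; first by rewrite -hk addn0; apply: I0.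
  by move=> q; rewrite /= e1 /= e2 /upd /= Ri Rb -hk addn0 subnn.
have [Ri Rb] := Ii _ _ _ hI.
have hI' := I0 _ _ _ (R b - R i) hI.
have kn : k < n by lia.
have [t [R1 [M1 [lt [R11 R1i hI1] et]]]] := hbody k kn P _ _ _ h2 hI'.
have := I0 _ _ _ 0 hI1 => /(IH k.+1) [|t' [R2 [M2 [lt' hI2 et']]]]; first by lia.
exists (2 + t + 3 + t'), R2, M2; split=> //; first by nia.
move=> q; rewrite -et' (_ : 2 + t + 3 + t' + q = (t + (t' + q).+3).+2); last by lia.
rewrite /= e1 /= e2 /=.
have -> : upd R 0 (R b - R i) 0 == 0 = false by rewrite /upd /= Ri Rb; lia.
by rewrite -[l.+3]addn3 et /= e3 /= e4 /= e5 /= R11 R1i addn1.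
Qed.

(** * Evaluating formulas in polynomial time *)

(** Fixes the initial state, so that later assertions can refer to it. *)
Lemma triple_init c T (Pre Post : store -> store -> Prop) :
  (forall R0 M0, Pre R0 M0 -> triple c T (fun R M => R = R0 /\ M = M0) Post) ->
  triple c T Pre Post.
Proof. by move=> h P l R M hc hp; apply: (h R M hp). Qed.

Lemma upd_same f a v : upd f a v a = v.
Proof. by rewrite /upd eqxx. Qed.

Lemma upd_other f a v i : i != a -> upd f a v i = f i.
Proof. by rewrite /upd => /negbTE->. Qed.

Inductive form :=
| Tru
| Adj (a b : nat)
| Eq (a b : nat)
| Mark (j a : nat)
| Not (f : form)
| And (f g : form)
| Ex (i : nat) (f : form)
| Lfp (i : nat) (f g : form).

Definition bind (T : Type) (f : nat -> T) (a : nat) (v : T) : nat -> T :=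
  fun i => if i == a then v else f i.

(* Element variables are named; set variables are numbered by nesting depth d.
   Lfp i f g evaluates g with the set variable d bound to the set obtained from
   the empty one by n sweeps that add, in place, every i satisfying f. *)
Fixpoint eval (G : sgraph) (d : nat) (E : nat -> nat -> bool) (e : nat -> nat)
    (p : form) : bool :=
  match p with
  | Tru => true
  | Adj a b => adj_entry G (e a) (e b)
  | Eq a b => e a == e b
  | Mark j a => (j < d) && E j (e a)
  | Not f => ~~ eval G d E e f
  | And f g => eval G d E e f && eval G d E e g
  | Ex i f => has (fun k => eval G d E (upd e i k) f) (iota 0 #|G|)
  | Lfp i f g =>
      let add X k := bind X k
        (X k || eval G d.+1 (bind E d X) (upd e i k) f) in
      let sweep X := foldl add X (iota 0 #|G|) in
      eval G d.+1 (bind E d (iter #|G| sweep (fun=> false))) e g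
  end.

(** Registers below 8 are reserved for constants and temporary values. Above them, even registers
    hold element variables and odd ones saved values, so the two supplies are infinite and
    disjoint. *)
Definition var (i : nat) : nat := i.*2 + 8.
Definition scr (i : nat) : nat := i.*2 + 9.

Definition block (c : program) : code := fun=> c.

(** Multiplication by [n], held in register 2, through repeated addition into register 5. *)
Definition cmul (a : nat) : code :=
  cseq (block [:: Const 5 0]) (cfor 6 a (block [:: Add 5 5 2])).

(** The set variables occupy consecutive blocks of [n] cells behind the adjacency matrix; register 5
    receives the address of the cell of element [a] in block [j]. *)
Definition caddr (j a : nat) : code :=
  cseq (block [:: Const 7 j])
    (cseq (cmul 7) (block [:: Add 5 5 3; Add 5 5 (var a)])).

(* The value of the formula ends up in register 4.  Registers 1, 2, 3 contain
   1, n and the address 1 + n * n of the first set variable, var i the element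
   variable i, and scr j for j < z values to be preserved. *)
Fixpoint compile (p : form) (z d : nat) : code :=
  match p with
  | Tru => block [:: Const 4 1]
  | Adj a b => cseq (cmul (var a))
      (block [:: Add 5 5 (var b); Add 5 5 1; Read 4 5])
  | Eq a b => block [:: Sub 4 (var a) (var b); Sub 5 (var b) (var a);
                        Add 4 4 5; Sub 4 1 4]
  | Mark j a => if j < d then cseq (caddr j a) (block [:: Read 4 5])
                else block [:: Const 4 0]
  | Not f => cseq (compile f z d) (block [:: Sub 4 1 4])
  | And f g =>
      cseq (compile f z d) (cseq (block [:: Const 0 0; Add (scr z) 4 0])
        (cseq (compile g z.+1 d) (block [:: Add 4 4 (scr z); Sub 4 4 1])))
  | Ex i f =>
      cseq (block [:: Const 0 0; Add (scr z) (var i) 0; Const (scr z.+1) 0])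
        (cseq (cfor (var i) 2 (cseq (compile f z.+2 d)
                (block [:: Add (scr z.+1) (scr z.+1) 4])))
          (block [:: Sub 4 1 (scr z.+1); Sub 4 1 4; Const 0 0;
                     Add (var i) (scr z) 0]))
  | Lfp i f g =>
      cseq (block [:: Const 0 0; Add (scr z) (var i) 0])
      (cseq (cfor (var i) 2 (cseq (caddr d i) (block [:: Const 4 0; Write 5 4])))
      (cseq (cfor (scr z.+1) 2 (cfor (var i) 2 (cseq (compile f z.+2 d.+1)
         (cseq (caddr d i)
           (block [:: Read 6 5; Add 4 4 6; Sub 4 1 4; Sub 4 1 4; Write 5 4])))))
      (cseq (block [:: Const 0 0; Add (var i) (scr z) 0])
        (compile g z d.+1))))
  end.

Fixpoint cost (p : form) (d n : nat) : nat :=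
  match p with
  | Tru => 1
  | Adj _ _ => 10 + 6 * n
  | Eq _ _ => 4
  | Mark j _ => 10 + 6 * j
  | Not f => cost f d n + 1
  | And f g => cost f d n + cost g d n + 4
  | Ex _ f => 10 + n * (cost f d n + 10)
  | Lfp _ f g => 10 + n * (6 * d + 20)
      + n * (n * (cost f d.+1 n + 6 * d + 30) + 10) + cost g d.+1 n
  end.

(** * Correctness and running time of compiled formulas *)

Section Correctness.

Variable G : sgraph.
Notation n := #|G|.

(** The input is required intact only up to address [n * n], since the set variables are stored
    above it. Blocks from [d] on may hold leftovers. *)
Definition inv (z : nat) (f : nat -> nat) (d : nat) (E : nat -> nat -> bool)
    (e : nat -> nat) (R M : store) : Prop :=
  [/\ [/\ R 1 = 1, R 2 = n & R 3 = 1 + n * n],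
      (forall i, R (var i) = e i),
      (forall j, j < z -> R (scr j) = f j),
      (forall a, a <= n * n -> M a = encode G a)
    & (forall j y, j < d -> y < n -> M (1 + n * n + j * n + y) = E j y)].

Lemma inv_temp r v z f d E e R M : r \in [:: 0; 4; 5; 6; 7] ->
  inv z f d E e R M -> inv z f d E e (upd R r v) M.
Proof.
rewrite !inE => hr [[h1 h2 h3] hv hs hm hE]; split=> //.
- by rewrite /upd; split; case: eqP => //; lia.
- by move=> i; rewrite -hv /upd /var; case: eqP => //; lia.
- by move=> j hj; rewrite -hs // /upd /scr; case: eqP => //; lia.
Qed.

Lemma inv_eq z z' f f' d E e e' R M : z <= z' -> (forall j, j < z -> f' j = f j) ->
  e' =1 e -> inv z' f' d E e' R M -> inv z f d E e R M.
Proof.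
move=> hz hf he [h1 hv hs hm hE]; split=> //.
  by move=> i; rewrite hv he.
by move=> j hj; rewrite hs ?hf //; apply: leq_trans hz.
Qed.

Lemma inv_scr j v z f d E e R M : j <= z ->
  inv z f d E e R M -> inv (maxn z j.+1) (upd f j v) d E e (upd R (scr j) v) M.
Proof.
move=> hj [[h1 h2 h3] hv hs hm hE]; split=> //.
- by rewrite /upd /scr; split; case: eqP => //; lia.
- by move=> i; rewrite -hv /upd /var /scr; case: eqP => //; lia.
- move=> k hk; rewrite /upd /scr; have [->|ne] := eqVneq k j; first by rewrite eqxx.
  by case: eqP => [|_]; [lia|apply: hs; lia].
Qed.

Lemma inv_var i v z f d E e R M :
  inv z f d E e R M -> inv z f d E (upd e i v) (upd R (var i) v) M.
Proof.
move=> [[h1 h2 h3] hv hs hm hE]; split=> //.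
- by rewrite /upd /var; split; case: eqP => //; lia.
- move=> k; rewrite /upd /var; have [->|ne] := eqVneq k i; first by rewrite eqxx.
  by case: eqP => [|_]; [lia|apply: hv].
- by move=> j hj; rewrite -hs // /upd /var /scr; case: eqP => //; lia.
Qed.

Lemma inv_write_above k v z f d E e R M :
  inv z f d E e R M -> inv z f d E e R (upd M (1 + n * n + d * n + k) v).
Proof.
move=> [h1 hv hs hm hE]; split=> //.
- by move=> a ha; rewrite -hm // upd_other //; lia.
- move=> j y jd hy; rewrite upd_other ?hE //.
  by have := leq_mul jd (leqnn n); rewrite mulSn; lia.
Qed.

Lemma inv_write (X : nat -> bool) k (b : bool) z f d E e R M : k < n ->
  inv z f d.+1 (bind E d X) e R M ->
  inv z f d.+1 (bind E d (bind X k b)) e R (upd M (1 + n * n + d * n + k) b).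
Proof.
move=> hk [h1 hv hs hm hE]; split=> //.
- by move=> a ha; rewrite -hm // /upd; case: eqP => //; lia.
- move=> j y hj hy; rewrite /upd; move: (hE j y hj hy); rewrite /bind.
  have [->|ne] := eqVneq j d.
    have [->|nk] := eqVneq y k; first by rewrite eqxx.
    by case: eqP => //; lia.
  move=> ->; case: eqP => // h; have : (j < d) by lia.
  by move=> jd; have := leq_mul jd (leqnn n); rewrite mulSn; lia.
Qed.

Lemma inv_regs z f d E e R M : inv z f d E e R M ->
  [/\ R 1 = 1, R 2 = n, R 3 = 1 + n * n & forall i, R (var i) = e i].
Proof. by case=> -[]. Qed.

(** The parameter [v] records that register 4 and the memory are preserved. Registers 0, 5 and 6 are
    overwritten and cannot hold the factor. *)
Lemma triple_mul a m v z f d E e : a \notin [:: 0; 5; 6] ->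
  triple (cmul a) (4 + 6 * m)
    (fun R M => [/\ inv z f d E e R M, (R 4, M) = v & R a = m])
    (fun R M => [/\ inv z f d E e R M, (R 4, M) = v & R 5 = m * n]).
Proof.
rewrite !inE !negb_or => /and3P[a0 a5 a6].
apply: (@triple_weaken _ (1 + (3 + m * (1 + 5)))
  _ _ _ (fun R M => [/\ inv z f d E e R M, (R 4, M) = v, R a = m, R 6 = m & R 5 = m * n]));
  [|lia|move=> R M; exact: id|by move=> R M []].
apply: (@triple_seq _ _ _ _ _ (fun R M => [/\ inv z f d E e R M, (R 4, M) = v, R a = m
  & R 5 = 0])).
  apply: (triple_block (c := [:: _])) => // R M [h h4 ha] /=; split=> //.
  - exact: inv_temp.
  - by rewrite /upd (negbTE a5).
apply: (triple_for (I := fun k R M =>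
  [/\ inv z f d E e R M, (R 4, M) = v, R a = m, R 6 = k & R 5 = k * n])) => //.
- move=> k R M w [h h4 ha h6 h5]; split=> //; first exact: inv_temp.
  by rewrite /upd (negbTE a0).
- by move=> k R M [].
- move=> R M [h h4 ha h5]; split=> //; first exact: inv_temp.
  by rewrite /upd (negbTE a6).
- move=> k hk; apply: (triple_block (c := [:: _])) => // R M [h h4 ha h6 h5] /=.
  have [r1 r2 _ _] := inv_regs h; split=> //; split=> //.
  + by apply: inv_temp => //; apply: inv_temp.
  + by rewrite /upd (negbTE a5) (negbTE a6).
  + by rewrite /upd /= r2 h5 mulSn addnC.
Qed.

Lemma triple_addr j a v z f d E e :
  triple (caddr j a) (7 + 6 * j)
    (fun R M => inv z f d E e R M /\ (R 4, M) = v)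
    (fun R M => [/\ inv z f d E e R M, (R 4, M) = v & R 5 = 1 + n * n + j * n + e a]).
Proof.
apply: (@triple_le _ (1 + (4 + 6 * j + 2))); last by lia.
apply: (triple_seq (Mid := fun R M => [/\ inv z f d E e R M, (R 4, M) = v & R 7 = j])).
  apply: (triple_block (c := [:: _])) => // R M [h h4] /=; split=> //.
  exact: inv_temp.
apply: triple_seq; first exact: triple_mul.
apply: (triple_block (c := [:: _; _])) => // R M [h h4 h5] /=.
have [r1 r2 r3 rv] := inv_regs h; split=> //; first by do 2!apply: inv_temp => //.
have := rv a; rewrite /upd /= /var; case: eqP => /= [|_]; first lia.
by move=> ->; rewrite h5 r3 (addnC (_ * _)).
Qed.

Definition correct (p : form) : Prop := forall z f d E e, (forall i, e i < n) ->
  triple (compile p z d) (cost p d n) (inv z f d E e)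
    (fun R M => inv z f d E e R M /\ R 4 = eval G d E e p).

Lemma encode_entry i j : i < n -> j < n -> encode G (i * n + j + 1) = adj_entry G i j.
Proof.
move=> hi hj; rewrite addn1 /= divnMDl ?(leq_ltn_trans _ hj) //.
by rewrite divn_small // addn0 modnMDl modn_small.
Qed.

Lemma correct_Adj a b : correct (Adj a b).
Proof.
move=> z f d E e he; apply: triple_init => R0 M0 h0; pose v := (R0 4, M0).
apply: (@triple_le _ (4 + 6 * e a + 3)).
  apply: (triple_seq (Mid := fun R M =>
    [/\ inv z f d E e R M, (R 4, M) = v & R 5 = e a * n])).
    apply: triple_weaken (@triple_mul _ (e a) v z f d E e _) (leqnn _) _ (fun _ _ => id).
      by rewrite !inE /var; lia.
    by move=> R M [-> ->]; have [_ _ _ ->] := inv_regs h0.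
  apply: (triple_block (c := [:: _; _; _])) => // R M [h h4 h5] /=.
  have [r1 r2 r3 rv] := inv_regs h; split=> //; first by do 3!apply: inv_temp => //.
  rewrite {1}/upd /= {1}/upd /= /upd /= h5 rv r1.
  have [_ _ _ hm _] := h; rewrite hm ?encode_entry //.
  have := he a; have := he b; move: (#|G|) => m; nia.
by rewrite /=; have := he a; move: (#|G|) => m; lia.
Qed.

(** With truncated subtraction, [(x - y) + (y - x)] is zero exactly when [x = y], and subtracting it
    from 1 gives the truth value. *)
Lemma correct_Eq a b : correct (Eq a b).
Proof.
move=> z f d E e he.
apply: (triple_block (c := [:: _; _; _; _])) => // R M h /=.
have [r1 r2 r3 rv] := inv_regs h; split; first by do 4!apply: inv_temp => //.
rewrite /upd /= r1; have := rv a; have := rv b; rewrite /var.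
do 2!(case: eqP => [|_]; first lia).
by move=> -> ->; case: eqP => [->|ne] /=; lia.
Qed.

Lemma correct_Mark j a : correct (Mark j a).
Proof.
move=> z f d E e he; rewrite /=; case: ltnP => jd /=; last first.
  apply: (@triple_le _ 1) => //; apply: (triple_block (c := [:: _])) => // R M h /=.
  by split=> //; apply: inv_temp.
apply: triple_init => R0 M0 h0; apply: (@triple_le _ (7 + 6 * j + 1)); last by lia.
apply: triple_seq.
  by apply: triple_pre (@triple_addr j a (R0 4, M0) z f d E e) _ => R M [-> ->].
apply: (triple_block (c := [:: _])) => // R M [h h4 h5] /=.
split; first exact: inv_temp.
by rewrite /upd /= h5; case: h => _ _ _ _ ->.
Qed.

Lemma correct_Not p : correct p -> correct (Not p).
Proof.
move=> hp z f d E e he; apply: triple_seq; first exact: hp.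
apply: (triple_block (c := [:: _])) => // R M [h h4] /=.
split; first exact: inv_temp.
by rewrite /upd /= h4; have [-> _ _ _] := inv_regs h; case: eval.
Qed.

(** The conjunction of two truth values is their sum minus 1, truncated. The first one waits in
    [scr z] while [q] is evaluated. *)
Lemma correct_And p q : correct p -> correct q -> correct (And p q).
Proof.
move=> hp hq z f d E e he.
apply: (@triple_le _ (cost p d n + (2 + (cost q d n + 2)))); last by rewrite /=; lia.
apply: triple_seq; first exact: hp.
set b := eval G d E e p.
apply: (triple_seq (Mid := inv z.+1 (upd f z b) d E e)).
  apply: (triple_block (c := [:: _; _])) => // R M [h h4] /=.
  rewrite {2}/upd /= {2}/upd /= addn0 h4.
  apply: (inv_eq (z' := maxn z z.+1) _ _ _ (inv_scr _ _ (inv_temp _ _ h))) => //; lia.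
apply: triple_seq; first exact: hq.
apply: (triple_block (c := [:: _; _])) => // R M [h h4] /=.
split; first do 2!apply: inv_temp => //.
  by apply: (inv_eq (z' := z.+1)) h => // j hj; rewrite /upd ltn_eqF.
have [r1 _ _ _] := inv_regs h; have [_ _ hs _ _] := h.
have := hs z (ltnSn z); rewrite /upd eqxx /= r1 /b h4 => ->.
by case: (eval G d E e p); case: (eval G d E e q).
Qed.

(** The outer value of variable [i] is saved in [scr z], and [scr z.+1] counts the elements
    satisfying [p]. Subtracting from 1 twice turns the count into a truth value. *)
Lemma correct_Ex i p : correct p -> correct (Ex i p).
Proof.
move=> hp z f d E e he.
rewrite [compile _ _ _]/=; pose c k := count (fun k => eval G d E (upd e i k) p) (iota 0 k).
pose I k := inv z.+2 (upd (upd f z (e i)) z.+1 (c k)) d E (upd e i k).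
apply: (@triple_le _ (3 + (3 + n * (cost p d n + 1 + 5) + 4))); last by rewrite /=; lia.
apply: (triple_seq (Mid := inv z.+2 (upd (upd f z (e i)) z.+1 0) d E e)).
  apply: (triple_block (c := [:: _; _; _])) => // R M h /=.
  have [_ _ _ rv] := inv_regs h; rewrite addn0 upd_other ?rv; last by rewrite /var; lia.
  apply: (inv_eq (z' := maxn (maxn z z.+1) z.+2) _ _ _
    (inv_scr _ _ (inv_scr _ _ (inv_temp _ _ h)))) => //; lia.
apply: (triple_seq (Mid := I n)).
  apply: triple_for => //.
  - by rewrite /var; lia.
  - by move=> k R M v; apply: inv_temp.
  - by move=> k R M h; have [_ r2 _ ->] := inv_regs h; rewrite /upd eqxx.
  - by move=> R M; apply: inv_var.
  move=> k hk; apply: triple_seq.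
    by apply: hp => j; rewrite /upd; case: eqP.
  apply: (triple_block (c := [:: _])) => // R M [h h4] /=.
  have [r1 r2 _ rv] := inv_regs h.
  have [_ _ hs _ _] := h; have := hs z.+1 (ltnSn _); rewrite upd_same => hc.
  split; first by rewrite upd_other // /scr; lia.
    by rewrite upd_other ?rv ?upd_same // /var /scr; lia.
  rewrite hc h4.
  apply: (inv_eq (z' := maxn z.+2 z.+2) _ _ _ (inv_var i _ (inv_scr _ _ h))) => //; try lia.
  + move=> j hj; rewrite /upd; case: eqP => // _.
    by rewrite /c -addn1 iotaD count_cat /= add0n addn0.
  + by move=> j; rewrite /upd; case: eqP.
apply: (triple_block (c := [:: _; _; _; _])) => // R M h /=.
have [r1 r2 _ rv] := inv_regs h; have [_ _ hs _ _] := h.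
have h1 := hs z.+1 (ltnSn _); have := hs z (ltnW (ltnSn _)).
rewrite upd_same in h1; rewrite upd_other ?upd_same => [h0|]; last by lia.
rewrite r1 h1; set a := (X in upd (upd _ 4 _) 4 X).
have -> : a = (0 < c n) by rewrite /a /upd /= r1; case: (c _).
split; last by rewrite has_count upd_other //= /var; lia.
rewrite addn0 !upd_other ?h0; try by rewrite /scr; lia.
apply: (inv_eq (z' := z.+2) _ _ _
  (inv_var i _ (inv_temp _ _ (inv_temp _ _ (inv_temp _ _ h))))) => //.
- by lia.
- by move=> j hj; rewrite !upd_other //; lia.
- by move=> j; rewrite /upd; case: eqP => // ->.
Qed.

(** Block [d] may contain the result of an earlier evaluation, so it is zeroed before the sweeps. *)
Lemma triple_clear i z f d E e : (forall j, e j < n) ->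
  triple (cfor (var i) 2 (cseq (caddr d i) (block [:: Const 4 0; Write 5 4])))
    (3 + n * (7 + 6 * d + 2 + 5)) (inv z f d E e)
    (inv z f d.+1 (bind E d (fun=> false)) (upd e i n)).
Proof.
move=> he.
apply: (@triple_weaken _ _ _ _ _ (fun R M => inv z f d E (upd e i n) R M /\
  forall y, y < n -> M (1 + n * n + d * n + y) = 0) _ _ (leqnn _) (fun _ _ => id));
  last first.
  move=> R M [[h1 hv hs hm hE] h0]; split=> // j y; rewrite ltnS leq_eqVlt /bind.
  by have [-> _ /h0//|_ /=] := eqVneq j d; apply: hE.
apply: (triple_for (I := fun k R M => inv z f d E (upd e i k) R M /\
  forall y, y < k -> M (1 + n * n + d * n + y) = 0)) => //.
- by rewrite /var; lia.
- by move=> k R M v [h h']; split=> //; apply: inv_temp.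
- by move=> k R M [h _]; have [_ r2 _ ->] := inv_regs h; rewrite upd_same.
- by move=> R M h; split=> //; apply: inv_var.
move=> k hk; apply: triple_init => R0 M0 [h0 c0]; apply: triple_seq.
  by apply: triple_pre (@triple_addr d i (R0 4, M0) z f d E (upd e i k)) _ => R M [-> ->].
apply: (triple_block (c := [:: _; _])) => // R M [h [_ eM] h5] /=.
have [r1 r2 _ rv] := inv_regs h; subst M.
split; first by rewrite upd_other.
  by rewrite upd_other ?rv ?upd_same // /var; lia.
rewrite upd_other // upd_same h5 upd_same; split.
  apply: (inv_eq (z' := z) _ _ _ (inv_var i k.+1
    (inv_temp (r := 4) 0 isT (inv_write_above _ _ h)))) => // j.
  by rewrite /upd; case: eqP.
move=> y; rewrite ltnS leq_eqVlt => /orP[/eqP->|yk]; first by rewrite upd_same.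
by rewrite upd_other ?c0 // eqn_add2l ltn_eqF.
Qed.

Definition sweep_step i p d E e (X : nat -> bool) k :=
  bind X k (X k || eval G d.+1 (bind E d X) (upd e i k) p).

(** Variable [i] is arbitrary at the start because the previous loop leaves it at [n]. *)
Lemma triple_sweep i p z f d E e X : correct p -> (forall j, e j < n) ->
  triple (cfor (var i) 2 (cseq (compile p z d.+1) (cseq (caddr d i)
      (block [:: Read 6 5; Add 4 4 6; Sub 4 1 4; Sub 4 1 4; Write 5 4]))))
    (3 + n * (cost p d.+1 n + (7 + 6 * d + 5) + 5))
    (fun R M => exists v, inv z f d.+1 (bind E d X) (upd e i v) R M)
    (inv z f d.+1 (bind E d (foldl (sweep_step i p d E e) X (iota 0 n))) (upd e i n)).
Proof.
move=> hp he.
pose Y k := foldl (sweep_step i p d E e) X (iota 0 k).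
apply: (triple_for (I := fun k => inv z f d.+1 (bind E d (Y k)) (upd e i k))).
- by rewrite /var; lia.
- by move=> k R M v; apply: inv_temp.
- by move=> k R M h; have [_ r2 _ ->] := inv_regs h; rewrite upd_same.
- move=> R M [v h]; apply: (inv_eq (z' := z) _ _ _ (inv_var i 0 h)) => // j.
  by rewrite /upd; case: eqP.
move=> k hk; apply: triple_seq.
  by apply: hp => j; rewrite /upd; case: eqP.
apply: triple_init => R0 M0 [h0 r0]; apply: triple_seq.
  by apply: triple_pre (@triple_addr d i (R0 4, M0) z f d.+1 (bind E d (Y k)) (upd e i k)) _
    => R M [-> ->].
apply: (triple_block (c := [:: _; _; _; _; _])) => // R M [h [h4 eM] h5] /=.
have [r1 r2 _ rv] := inv_regs h; subst M0.
rewrite upd_same in h5.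
set b := eval _ _ _ _ _ in r0.
have hM : M (R 5) = Y k k.
  by rewrite h5; case: h => _ _ _ _ ->; rewrite // /bind eqxx.
set R' := upd (upd (upd _ 4 _) 4 _) 4 _.
have hR' : inv z f d.+1 (bind E d (Y k)) (upd e i k) R' M.
  by do 4!apply: inv_temp => //.
have e4 : R' 4 = (Y k k || b).
  by rewrite /R' /upd /= r1 h4 r0 hM; case: (b); case: (Y k k).
have [r1' _ _ rv'] := inv_regs hR'; rewrite rv' upd_same r1' e4; split=> //.
rewrite [X in upd M X](_ : _ = 1 + n * n + d * n + k); last by rewrite /R' /upd /=.
have -> : Y k.+1 = bind (Y k) k (Y k k || b).
  by rewrite /Y -[k.+1]addn1 iotaD foldl_cat.
apply: (inv_eq (z' := z) _ _ _ (inv_var i k.+1 (inv_write _ _ hR'))) => // j.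
by rewrite /upd; case: eqP.
Qed.

(** During the sweeps [scr z] keeps the outer value of variable [i] and [scr z.+1] counts the
    sweeps; both are released before [q] is evaluated. *)
Lemma correct_Lfp i p q : correct p -> correct q -> correct (Lfp i p q).
Proof.
move=> hp hq z f d E e he; rewrite [compile _ _ _]/=.
pose f' := upd f z (e i); pose X k := iter k
  (fun X => foldl (sweep_step i p d E e) X (iota 0 n)) (fun=> false).
apply: (@triple_le _ (2 + ((3 + n * (7 + 6 * d + 2 + 5)) +
  ((3 + n * (3 + n * (cost p d.+1 n + (7 + 6 * d + 5) + 5) + 5)) +
   (2 + cost q d.+1 n))))).
  apply: (triple_seq (Mid := inv z.+1 f' d E e)).
    apply: (triple_block (c := [:: _; _])) => // R M h /=.
    have [_ _ _ rv] := inv_regs h; rewrite addn0 upd_other ?rv; last by rewrite /var; lia.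
    apply: (inv_eq (z' := maxn z z.+1) _ _ _ (inv_scr _ _ (inv_temp _ _ h))) => //; lia.
  apply: triple_seq; first exact: triple_clear.
  pose I k R M := exists v,
    inv z.+2 (upd f' z.+1 k) d.+1 (bind E d (X k)) (upd e i v) R M.
  apply: (triple_seq (Mid := I n)).
    apply: triple_for => //.
    - by move=> k R M v [w h]; exists w; apply: inv_temp.
    - move=> k R M [w h]; have [_ r2 _ _] := inv_regs h; case: h => _ _ h _ _.
      by rewrite h // upd_same.
    - move=> R M h; exists n.
      by apply: (inv_eq (z' := maxn z.+1 z.+2) _ _ _ (inv_scr _ _ h)) => //; lia.
    move=> k hk; apply: triple_weaken
      (@triple_sweep i p z.+2 (upd f' z.+1 k) d E e (X k) hp he) (leqnn _) _ _.
      by move=> R M; exact: id.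
    move=> R M h; have [r1 r2 _ rv] := inv_regs h.
    have [_ _ hs _ _] := h; split=> //; first by rewrite hs // upd_same.
    exists n; apply: (inv_eq (z' := maxn z.+2 z.+2) _ _ _ (inv_scr _ _ h)) => //; try lia.
    by move=> j hj; rewrite /upd; case: eqP.
  apply: triple_seq; last first.
    apply: triple_weaken (hq z f d.+1 (bind E d (X n)) e he) (leqnn _) (fun _ _ => id) _.
    move=> R M [[h1 hv hs hm hE] h4]; split=> //; split=> // j y hj hy.
    by rewrite hE /bind ?ltn_eqF // ltnW.
  apply: (triple_block (c := [:: _; _])) => // R M [v h] /=.
  have [_ _ hs _ _] := h.
  rewrite addn0 upd_other ?hs //; last by rewrite /scr; lia.
  rewrite upd_other /f' ?upd_same; last by lia.
  apply: (inv_eq (z' := z.+2) _ _ _ (inv_var i _ (inv_temp _ _ h))) => //; try lia.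
  - by move=> j hj; rewrite /f' !upd_other //; lia.
  - by move=> j; rewrite /upd; case: eqP => // ->.
rewrite [X in _ <= X]/=; move: (#|G|) => m; move: (cost p _ m) (cost q _ m) => c c'.
have hA : m * (7 + 6 * d + 2 + 5) <= m * (6 * d + 20) by rewrite leq_mul //; lia.
have hB : m * (c + (7 + 6 * d + 5) + 5) <= m * (c + 6 * d + 30) by rewrite leq_mul //; lia.
have hC : m * (3 + m * (c + (7 + 6 * d + 5) + 5) + 5) <= m * (m * (c + 6 * d + 30) + 10).
  by rewrite leq_mul // (addnC 3) -addnA leq_add.
by clear -hA hC; lia.
Qed.

Lemma compile_correct p : correct p.
Proof.
elim: p.
- move=> z f d E e he; apply: (triple_block (c := [:: _])) => // R M h /=.
  by split=> //; apply: inv_temp.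
- exact: correct_Adj.
- exact: correct_Eq.
- exact: correct_Mark.
- exact: correct_Not.
- by move=> *; apply: correct_And.
- by move=> *; apply: correct_Ex.
- by move=> *; apply: correct_Lfp.
Qed.

End Correctness.

(** * Polynomial bounds and the decision program *)

Definition poly_bounded (f : nat -> nat) : Prop :=
  exists C K, forall n, f n <= C * n.+1 ^ K.

Lemma poly_bounded_const c : poly_bounded (fun=> c).
Proof. by exists c, 0 => n; rewrite muln1. Qed.

Lemma poly_bounded_id : poly_bounded id.
Proof. by exists 1, 1 => n; rewrite mul1n expn1. Qed.

(** The base [n.+1] is positive, so both exponents can be raised to their sum. *)
Lemma poly_bounded_add f g :
  poly_bounded f -> poly_bounded g -> poly_bounded (fun n => f n + g n).
Proof.
move=> [C [K hf]] [C' [K' hg]]; exists (C + C'), (K + K') => n.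
rewrite mulnDl leq_add //.
  by apply: leq_trans (hf n) _; rewrite leq_mul // leq_pexp2l // leq_addr.
by apply: leq_trans (hg n) _; rewrite leq_mul // leq_pexp2l // leq_addl.
Qed.

Lemma poly_bounded_mul f g :
  poly_bounded f -> poly_bounded g -> poly_bounded (fun n => f n * g n).
Proof.
move=> [C [K hf]] [C' [K' hg]]; exists (C * C'), (K + K') => n.
by rewrite expnD mulnACA leq_mul.
Qed.

Lemma poly_bounded_cost p d : poly_bounded (cost p d).
Proof.
elim: p d => [|a b|a b|j a|p IHp|p IHp q IHq|i p IHp|i p IHp q IHq] d /=;
  repeat first [exact: poly_bounded_const | exact: IHp | exact: IHq
    | exact: poly_bounded_id | apply: poly_bounded_add | apply: poly_bounded_mul].
Qed.

Definition decider_body (p : form) : code :=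
  cseq (block [:: Const 3 0]) (cseq (cfor 6 2 (block [:: Add 3 3 2]))
    (cseq (block [:: Add 3 3 1]) (compile p 0 0))).

Lemma triple_decider_body (G : sgraph) p : 0 < #|G| ->
  triple (decider_body p) (5 + 6 * #|G| + cost p 0 #|G|)
    (fun R M => [/\ R = upd (upd (fun=> 0) 2 #|G|) 1 1 & M = encode G])
    (fun R _ => R 4 = eval G 0 (fun _ _ => false) (fun=> 0) p).
Proof.
move=> n0; apply: (@triple_le _ (1 + ((3 + #|G| * (1 + 5)) + (1 + cost p 0 #|G|))));
  last by rewrite mulnC; lia.
pose I k (R M : store) := [/\ [/\ R 1 = 1, R 2 = #|G|, R 6 = k & R 3 = k * #|G|],
  forall i, R (var i) = 0 & M = encode G].
apply: (triple_seq (Mid := fun R M => I 0 (upd R 6 0) M)).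
  apply: (triple_block (c := [:: _])) => // R M [-> ->] /=; split=> // i.
  by rewrite /upd /var !ifF //; lia.
apply: (triple_seq (Mid := I #|G|)).
  apply: triple_for => //.
  - move=> k R M v [h hv hM]; split=> // i.
    by rewrite upd_other ?hv // /var; lia.
  - by move=> k R M [[]].
  move=> k hk; apply: (triple_block (c := [:: _])) => // R M [[h1 h2 h6 h3] hv hM] /=.
  split=> //; split=> //.
    by split=> //; rewrite /upd /= h2 h3 mulSn addnC.
  by move=> i; rewrite !upd_other ?hv // /var; lia.
apply: (triple_seq (Mid := inv G 0 (fun=> 0) 0 (fun _ _ => false) (fun=> 0))).
  apply: (triple_block (c := [:: _])) => // R M [[h1 h2 h6 h3] hv ->] /=; split=> //.
  - by split=> //; rewrite upd_same h1 h3 addnC.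
  - by move=> i; rewrite upd_other ?hv // /var; lia.
apply: triple_weaken (@compile_correct G p 0 _ 0 _ _ (fun=> n0)) (leqnn _) (fun _ _ => id) _.
by move=> R M [].
Qed.

(** The program has [size c + 5] instructions, so a jump to that address rejects. The empty graph is
    rejected at once, as the correctness of compiled formulas requires element variables with values
    below [n]. *)
Definition decider (p : form) : program :=
  let c := decider_body p 3 in
  [:: Read 2 0; Jzero 2 (size c + 5); Const 1 1] ++ c ++
  [:: Jzero 4 (size c + 5); Halt true].

Lemma exec_decider (G : sgraph) p t : 10 + 6 * #|G| + cost p 0 #|G| <= t ->
  exec (decider p) t (init G) =
  Some ((0 < #|G|) && eval G 0 (fun _ _ => false) (fun=> 0) p).
Proof.
move=> ht; set P := decider p; set c := decider_body p 3.
have hend : nth (Halt false) P (size c + 5) = Halt false.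
  by rewrite nth_default // /P /decider /= size_cat /= -/c addnS; lia.
have hc : code_at P 3 c.
  have [_] := @code_at_cat P 0 [:: Read 2 0; Jzero 2 (size c + 5); Const 1 1] _
    (fun i hi => erefl).
  by move/code_at_cat => [].
have hj i : i < 2 -> nth (Halt false) P (3 + size c + i) =
    nth (Halt false) [:: Jzero 4 (size c + 5); Halt true] i.
  move=> hi; rewrite /P /decider -/c catA nth_cat size_cat ltnNge leq_addr /=.
  by rewrite addKn.
have hj0 : nth (Halt false) P (3 + size c) = Jzero 4 (size c + 5).
  by have := hj 0 isT; rewrite addn0.
have hj1 : nth (Halt false) P (3 + size c).+1 = Halt true.
  by have := hj 1 isT; rewrite addn1.
have p0 : nth (Halt false) P 0 = Read 2 0 by [].
have p1 : nth (Halt false) P 1 = Jzero 2 (size c + 5) by [].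
have p2 : nth (Halt false) P 2 = Const 1 1 by [].
clearbody P; rewrite (_ : t = (t - 3).+3) /=; last by lia.
rewrite p0 /= p1 /= upd_same; case: posnP => n0; first by rewrite hend.
rewrite p2 /set_reg /=.
have [t' [R [M [lt h4 he]]]] := @triple_decider_body G p n0 P 3 _ _ hc
  (conj erefl erefl).
rewrite (_ : t - 3 = t' + (t - 3 - t' - 2).+2); last by lia.
rewrite he -/c; clearbody c; rewrite /= hj0 /= h4; case: eval => /=; first by rewrite hj1.
by rewrite hend.
Qed.

Lemma form_decidable p : poly_time_decidable
  (fun G => (0 < #|G|) && eval G 0 (fun _ _ => false) (fun=> 0) p).
Proof.
have [C [K hC]] : poly_bounded (fun n => 10 + 6 * n + cost p 0 n).
  by repeat first [exact: poly_bounded_const | exact: poly_bounded_cost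
    | exact: poly_bounded_id | apply: poly_bounded_add | apply: poly_bounded_mul].
exists (decider p), (C * 2 ^ K), K => G; eexists; last exact: iff_refl.
apply: exec_decider; apply: leq_trans (hC _) _.
have h : #|G| <= gsize G by apply: leq_addr.
(* For positive [n] the factor [2 ^ K] comes from [n + 1 <= 2 * n]; for [n = 0] the additive
   constant suffices. *)
case n0: (#|G|) => [|n].
  by rewrite exp1n muln1 (leq_trans _ (leq_addl _ _)) // leq_pmulr ?expn_gt0.
rewrite (leq_trans _ (leq_addr _ _)) // -mulnA leq_mul // -expnMn.
by case: (K) => // k; rewrite leq_exp2r //; lia.
Qed.

(** * The formula of a flower *)

Section Sweeps.

Variable P : (nat -> bool) -> nat -> bool.
Let add (X : nat -> bool) k := bind X k (X k || P X k).

Lemma sweep_mono s (X : nat -> bool) i : X i -> foldl add X s i.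
Proof.
by elim: s X => //= k s IH X Xi; apply: IH; rewrite /add /bind; case: eqP => // <-; rewrite Xi.
Qed.

(** The set is updated in place: when the turn of [k] comes it contains [X] but may have grown,
    hence the hypothesis about all supersets. *)
Lemma sweep_hit s (X : nat -> bool) k : k \in s ->
  (forall Y : nat -> bool, (forall i, X i -> Y i) -> P Y k) -> foldl add X s k.
Proof.
elim: s X => //= c s IH X; rewrite inE => /orP[/eqP<-|ks] h.
  by apply: sweep_mono; rewrite /add /bind eqxx h ?orbT.
apply: IH => // Y hY; apply: h => i Xi; apply: hY.
exact: (@sweep_mono [:: c]).
Qed.

Lemma sweep_sound (Q : nat -> Prop) s (X : nat -> bool) :
  (forall (Y : nat -> bool) k, (forall i, Y i -> Q i) -> k \in s -> P Y k -> Q k) ->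
  (forall i, X i -> Q i) -> forall i, foldl add X s i -> Q i.
Proof.
elim: s X => //= c s IH X h hX; apply: IH => [Y k hY ks|].
  by apply: h hY _; rewrite inE ks orbT.
move=> i; rewrite /add /bind; case: eqP => [->|_]; last exact: hX.
by case/orP=> [/hX //|]; apply: h; rewrite ?inE ?eqxx.
Qed.

End Sweeps.

Definition Conj (H : finType) (f : H -> form) : form := foldr And Tru (map f (enum H)).

Lemma eval_Conj G d E e (H : finType) (f : H -> form) :
  eval G d E e (Conj f) = [forall x, eval G d E e (f x)].
Proof.
have -> : eval G d E e (Conj f) = all (fun x => eval G d E e (f x)) (enum H).
  by rewrite /Conj; elim: (enum H) => //= x s ->.
by apply/allP/forallP => h x; [apply: h; rewrite mem_enum | move=> _; apply: h].
Qed.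

Lemma eval_Ex_elim (G : sgraph) d E e s f : eval G d E e (foldr Ex f s) ->
  exists2 e', forall i, i \in s -> e' i < #|G| & eval G d E e' f.
Proof.
(* Agreement with [e] outside [s] is added for the induction: it shows that the value of the
   outermost variable survives. *)
suff h : eval G d E e (foldr Ex f s) -> exists e',
    [/\ forall i, i \notin s -> e' i = e i, forall i, i \in s -> e' i < #|G|
      & eval G d E e' f] by move=> /h[e' [_ ? ?]]; exists e'.
elim: s e => [|c s IH] e /=; first by exists e.
case/hasP=> k; rewrite mem_iota /= => hk /IH[e' [h1 h2 h3]]; exists e'; split=> // i.
  by rewrite inE negb_or => /andP[ic /h1->]; rewrite upd_other.
rewrite inE => /orP[/eqP->|]; last exact: h2.
by have [/h2|/h1->] := boolP (c \in s); rewrite ?upd_same.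
Qed.

(** The environment reached inside nested quantifiers over [s] when each variable [i] receives the
    value [a i]. *)
Definition assign (a e : nat -> nat) (s : seq nat) : nat -> nat :=
  foldl (fun e i => upd e i (a i)) e s.

Lemma assign_mem a e s i : i \in s -> assign a e s i = a i.
Proof.
rewrite /assign; elim/last_ind: s => // s c IH; rewrite foldl_rcons mem_rcons inE.
by rewrite /upd; case: eqP => [->|_ /IH].
Qed.

Lemma eval_Ex_intro (G : sgraph) d E e a s f : (forall i, i \in s -> a i < #|G|) ->
  eval G d E (assign a e s) f -> eval G d E e (foldr Ex f s).
Proof.
elim: s e => //= c s IH e ha hf; apply/hasP; exists (a c).
  by rewrite mem_iota ha ?inE ?eqxx.
by apply: IH hf => i hi; apply: ha; rewrite inE hi orbT.
Qed.

Lemma adj_entry_rank (G : sgraph) (a b : G) :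
  adj_entry G (enum_rank a) (enum_rank b) = sedge a b.
Proof. by rewrite /adj_entry !valK !enum_rankK. Qed.

Section Formula.

Variables (H : sgraph) (u : H).

Notation hv x := (nat_of_ord (enum_rank (x : H))).
Notation vy := #|H|.
Notation vz := #|H|.+1.

(** The variable numbered by the rank of [x] stands for [v x]; [vy] and [vz] are fresh. Since [H] is
    fixed, conditions on [H] are decided while the formula is built. *)
Definition allowed_form (a : nat) : form := Conj (fun x : H =>
  if x == u then Tru else
  And (Not (Eq a (hv x))) (if sedge u x then Tru else Not (Adj (hv x) a))).

Definition induced_form : form := Conj (fun x : H => Conj (fun y : H =>
  if [|| x == u, y == u | x == y] then Tru else
  And (Not (Eq (hv x) (hv y)))
      (if sedge x y then Adj (hv x) (hv y) else Not (Adj (hv x) (hv y))))).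

(** One step of the search for the component of [v u]: an allowed vertex is added if it is [v u] or
    has a neighbour in the current set. The disjunction is written with negations. *)
Definition reach_form : form := And (allowed_form vy)
  (Not (And (Not (Eq vy (hv u)))
            (Not (Ex vz (And (Mark 0 vz) (Adj vz vy)))))).

Definition attach_form : form := And (allowed_form (hv u)) (Conj (fun x : H =>
  if sedge u x then Ex vz (And (Mark 0 vz) (Adj (hv x) vz)) else Tru)).

Definition witness_form : form := And induced_form (Lfp vy reach_form attach_form).

Definition flower_form : form := foldr Ex witness_form (iota 0 #|H|).

Section Semantics.

Variables (G : sgraph) (v : H -> G).

Notation rk w := (nat_of_ord (enum_rank (w : G))).
Notation A := (allowed u v).

Definition codes (e : nat -> nat) : Prop := forall x, e (hv x) = rk (v x).

Lemma codes_upd e i k : codes e -> #|H| <= i -> codes (upd e i k).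
Proof.
move=> he hi x; rewrite upd_other ?he //.
by rewrite ltn_eqF //; apply: leq_trans (ltn_ord _) hi.
Qed.

Lemma rk_eq (a b : G) : (rk a == rk b) = (a == b).
Proof. by rewrite (inj_eq val_inj) (inj_eq enum_rank_inj). Qed.

Lemma eval_allowed d E e a w : codes e -> e a = rk w ->
  eval G d E e (allowed_form a) = (w \in A).
Proof.
move=> he ea; rewrite eval_Conj inE; apply: eq_forallb => x.
case: eqP => //= _; rewrite ea he rk_eq; congr (_ && _).
by case: (sedge u x) => //=; rewrite he ea adj_entry_rank.
Qed.

Lemma eval_induced d E e : codes e ->
  reflect (forall x y, x != u -> y != u -> x != y ->
             v x != v y /\ sedge (v x) (v y) = sedge x y)
          (eval G d E e induced_form).
Proof.
move=> he; rewrite eval_Conj; apply: (iffP forallP) => h x.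
  move=> y xu yu xy; have := h x; rewrite eval_Conj => /forallP/(_ y).
  rewrite (negbTE xu) (negbTE yu) (negbTE xy) /= !he rk_eq => /andP[-> ].
  by case: (sedge x y) => /=; rewrite !he adj_entry_rank; [move=> ->|move/negbTE->].
rewrite eval_Conj; apply/forallP => y; case: ifP => // /negbT.
rewrite !negb_or => /and3P[xu yu xy]; have [vxy vE] := h x y xu yu xy.
by rewrite /= !he rk_eq vxy /= -vE; case se: (sedge (v x) (v y)); rewrite /= !he adj_entry_rank se.
Qed.

Lemma has_rankP (p : pred nat) :
  reflect (exists w : G, p (rk w)) (has p (iota 0 #|G|)).
Proof.
apply: (iffP hasP) => [[k]|[w h]]; last first.
  by exists (rk w) => //; rewrite mem_iota /= ltn_ord.
rewrite mem_iota /= => hk h; exists (enum_val (Ordinal hk)).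
by rewrite enum_valK.
Qed.

Lemma eval_reach E e (X : nat -> bool) w : codes e ->
  reflect (w \in A /\ (w = v u \/ exists2 a, X (rk a) & sedge a w))
          (eval G 1 (bind E 0 X) (upd e vy (rk w)) reach_form).
Proof.
move=> he; have he' : codes (upd e vy (rk w)) by apply: codes_upd.
rewrite /reach_form /= (eval_allowed _ _ he' (w := w)) ?upd_same // he' rk_eq.
rewrite negb_and !negbK; apply: (iffP andP) => -[wA h]; split=> //.
  case/orP: h => [/eqP|/has_rankP[a]]; first by left.
  rewrite upd_same upd_other ?upd_same; last by rewrite ltn_eqF.
  by rewrite adj_entry_rank => /andP[]; right; exists a.
case: h => [->|[a Xa e_aw]]; first by rewrite eqxx.
apply/orP; right; apply/has_rankP; exists a.
rewrite upd_same upd_other ?upd_same; last by rewrite ltn_eqF.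
by rewrite adj_entry_rank e_aw andbT.
Qed.

(** After [#|G|] sweeps the set is the component of [v u]: every added vertex is reachable, and [m]
    sweeps reach the end of each path with fewer than [m] edges. *)
Lemma eval_witness E e : codes e -> reflect (witness u v) (eval G 0 E e witness_form).
Proof.
move=> he; rewrite /witness_form /=.
set P := fun (X : nat -> bool) k => eval G 1 (bind E 0 X) (upd e vy k) reach_form.
set X := iter _ _ _.
pose sweep (X : nat -> bool) :=
  foldl (fun X k => bind X k (X k || P X k)) X (iota 0 #|G|).
have inI (w : G) : rk w \in iota 0 #|G| by rewrite mem_iota /= ltn_ord.
(* The premise matters: [connect] is reflexive, whereas [reach_form] adds [v u] only if it is
   allowed. *)
have XP w : v u \in A -> X (rk w) = connect (radj A) (v u) w.
  move=> uA; apply/idP/idP.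
    pose Q k := exists w, rk w = k /\ connect (radj A) (v u) w.
    suff : forall m i, iter m sweep (fun=> false) i -> Q i.
      by move=> h /h[w' [/val_inj/enum_rank_inj<-]].
    elim=> // m IH i /=; apply: sweep_sound IH i => Y k hY.
    rewrite mem_iota /= => hk; rewrite /P.
    have -> : k = rk (enum_val (Ordinal hk)) by rewrite enum_valK.
    move: (enum_val _) => w' /(eval_reach _ _ _ he)[wA hw]; exists w'; split=> //.
    case: hw => [->|[a /hY[a' [/val_inj/enum_rank_inj<- ca]] e_aw]]; first exact: connect0.
    apply: connect_trans (ca) _; apply: connect1; rewrite /radj wA e_aw !andbT.
    case/connectP: ca => p; elim/last_ind: p a' {e_aw} => [|p c _] a' /=; first by move=> _ ->.
    by rewrite rcons_path last_rcons => /andP[_ /and3P[_ cA _]] ->.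
  (* A path without repetitions has fewer than [#|G|] edges, so [#|G|] sweeps suffice. *)
  case/connectP=> p0 hp0 ->; case: (shortenP hp0) => p hp up _.
  have szp : size p < #|G|.
    by rewrite -[(size p).+1]/(size (v u :: p)) -(card_uniqP up) max_card.
  suff h m : forall q, path (radj A) (v u) q -> size q < m ->
      iter m sweep (fun=> false) (rk (last (v u) q)) by exact: h.
  elim: m => // m IH; elim/last_ind => [|q c _] hq sq /=.
    by apply: sweep_hit => // Y _; apply/eval_reach => //; split=> //; left.
  move: hq sq; rewrite rcons_path last_rcons size_rcons => /andP[hq /and3P[_ cA ec]] sq.
  apply: sweep_hit => // Y hY; apply/eval_reach => //; split=> //; right.
  by exists (last (v u) q) => //; apply: hY; apply: IH.
rewrite (eval_allowed _ _ he (he u)) eval_Conj.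
apply: (iffP and3P) => [[/(eval_induced _ _ he) h1 uA /forallP h3]|[h1 uA h3]]; split=> //.
- move=> x ux; have := h3 x; rewrite ux => /has_rankP[w].
  rewrite /= upd_same codes_upd // adj_entry_rank /bind eqxx XP // => /andP[cw e_w].
  by exists w.
- exact/eval_induced.
- apply/forallP => x; case: ifP => // /h3[w cw e_w]; apply/has_rankP; exists w.
  by rewrite /= upd_same codes_upd // adj_entry_rank e_w /bind eqxx XP // cw.
Qed.

End Semantics.

Lemma eval_flower_form (G : sgraph) E e :
  eval G 0 E e flower_form <-> exists v : H -> G, witness u v.
Proof.
split=> [/eval_Ex_elim[e' he' hw]|[v wv]].
  have lt x : e' (hv x) < #|G| by apply: he'; rewrite mem_iota /= ltn_ord.
  exists (fun x => enum_val (Ordinal (lt x))); apply/(eval_witness E) : hw => x.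
  by rewrite enum_valK.
pose a i := if insub i is Some j then nat_of_ord (enum_rank (v (enum_val (j : 'I_#|H|))))
            else 0.
have ha x : a (hv x) = enum_rank (v x) by rewrite /a valK enum_rankK.
apply: (eval_Ex_intro (a := a)) => [i|].
  rewrite mem_iota /= => hi; rewrite -[i]/(nat_of_ord (Ordinal hi)).
  by rewrite -(enum_valK (Ordinal hi)) ha ltn_ord.
apply/(introT (eval_witness _ _)): wv => x; rewrite assign_mem ?ha //.
by rewrite mem_iota /= ltn_ord.
Qed.

End Formula.

Theorem theorem1p1 (H : sgraph) (hH : flower H) :
  poly_time_decidable (fun G : sgraph => induced_minor H G).
Proof.
have [u [ps [hps hpet]]] := hH.
have [P [c [k hP]]] := form_decidable (flower_form u).
exists P, c, k => G; have [b hb hbP] := hP G; exists b => //.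
rewrite hbP (flower_witness G hps hpet).
have ew := eval_flower_form u G (fun _ _ => false) (fun=> 0).
split=> [/andP[_]|]; first by rewrite ew.
(* Rejecting the empty graph is right: a witness provides the vertex [v u] of [G]. *)
move=> hw; apply/andP; split; last by rewrite ew.
by have [v _] := hw; apply/card_gt0P; exists (v u).
Qed.
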